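(* For all integers $k\ge 1$ and $n\ge 2$, the $2k$-th symmetrized crank moment $\mu_{2k}(n)$ is equal to the number of $(k+1)$-marked Dyson symbols of $n$.
   Context: **Crank and crank moments.** For a partition $\lambda=(\lambda_1\ge\lambda_2\ge\cdots)$, let $n_1(\lambda)$ be the number of ones in $\lambda$ and $\mu(\lambda)$ the number of parts of $\lambda$ larger than $n_1(\lambda)$. The crank of $\lambda$ is $\lambda_1$ if $n_1(\lambda)=0$, and $\mu(\lambda)-n_1(\lambda)$ if $n_1(\lambda)>0$. For $n>1$, $M(m,n)$ is the number of partitions of $n$ with crank $m$. For $k\ge1$, $$\mu_{2k}(n)=\sum_{m=-\infty}^{+\infty}\binom{m+k-1}{2k}M(m,n),$$ where $\binom{x}{j}=x(x-1)\cdots(x-j+1)/j!$ for every integer $x$ (possibly negative). **Notation.** Partitions may be empty. For a partition $\alpha$, $\ell(\alpha)$ is its number of parts, $|\alpha|$ the sum of its parts, and $\alpha_j$ its $j$-th largest part. **$k$-marked Dyson symbols ($k\ge2$).** A $k$-marked Dyson symbol $\eta$ consists of $k$ pairs of partitions $(\alpha^{(i)},\beta^{(i)})$, $1\le i\le k$, and a partition $p=(p_{k-1},\ldots,p_1,p_0)$, such that: (1) $p_{k-1}\ge\cdots\ge p_1\ge p_0=1$; (2) for $1\le i\le k-1$, every part $x$ of $\alpha^{(i)}$ and of $\beta^{(i)}$ satisfies $p_{i-1}\le x\le p_i$; (3) every part of $\alpha^{(k)}$ and of $\beta^{(k)}$ is at least $p_{k-1}$; (4) if $\ell(\alpha^{(k)})=1$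 then $\alpha^{(k)}_1=p_{k-1}$; if $\ell(\alpha^{(k)})>1$ then $\alpha^{(k)}_1=\alpha^{(k)}_2$; if $\ell(\alpha^{(k)})=0$ and $\ell(\beta^{(k)})=1$ then $\beta^{(k)}_1=p_{k-1}$; if $\ell(\alpha^{(k)})=0$ and $\ell(\beta^{(k)})\ge2$ then $\beta^{(k)}_1=\beta^{(k)}_2$; if $\ell(\alpha^{(k)})=0$ and $\ell(\beta^{(k)})=0$ then $p_{k-1}=\max\{\alpha^{(k-1)}_1,\beta^{(k-1)}_1\}$. **Balanced parts.** For partitions $(\alpha,\beta)$ with $\ell(\alpha)\ge\ell(\beta)$, the parts $\beta_1,\beta_2,\ldots$ of $\beta$ are declared balanced or unbalanced recursively: $\beta_i$ is balanced if the number of parts of $\alpha$ greater than $\beta_i$ equals the number of unbalanced parts $\beta_j$ with $1\le j<i$; otherwise it is unbalanced. Let $b(\alpha,\beta)$ be the number of balanced parts. For $1\le i<k$ put $b_i(\eta)=b(\alpha^{(i)},\beta^{(i)})$ if $\ell(\alpha^{(i)})\ge\ell(\beta^{(i)})$ and $b_i(\eta)=b(\beta^{(i)},\alpha^{(i)})$ otherwise; put $b_k(\eta)=0$. **Weight.** Let $l(\eta)=\sum_{i=1}^k\max\{\ell(\alpha^{(i)}),\ell(\beta^{(i)})\}$, $s(\eta)=\sum_{i=1}^k\min\{\ell(\alpha^{(i)}),\ell(\beta^{(i)})\}$, $D=\sum_{i=1}^k b_i(\eta)$. The weight of $\eta$ is $$|\eta|=\sum_{i=1}^k(|\alpha^{(i)}|+|\beta^{(i)}|)+\sum_{i=1}^{k-1}p_i+(l(\eta)+D+k-1)(s(\eta)-D),$$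 and $\eta$ is a $k$-marked Dyson symbol of $n$ if $|\eta|=n$.
   Formalization: In the last clause of condition (4), the largest part of an empty partition, left undefined, is read as p_{k-2}; so if the last two pairs of a k-marked Dyson symbol are all empty, the condition says p_{k-1}=p_{k-2}. *)

(* Defs.v *)
From HB Require Import structures.
From mathcomp Require Import all_boot all_order all_algebra finmap.
From mathcomp Require Import boolp classical_sets functions cardinality fsbigop.

Set Implicit Arguments.
Unset Strict Implicit.
Unset Printing Implicit Defensive.

Import Order.TTheory GRing.Theory Num.Theory.

(* The number of elements of a finite set A : set T is written #|` fset_set A|.
   This is 0 by convention when A is infinite; the lemmas finite_partitions,
   finite_crank_support and finite_marked_Dyson_symbols below show that this
   case never occurs here. *)

(** * Partitions *)

Record partn := Partn {
  parts :> seq nat;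
  partsP : sorted geq parts && (0 \notin parts) }.

HB.instance Definition _ := [isSub for parts].
HB.instance Definition _ := [Countable of partn by <:].

Definition empty_partn : partn := @Partn [::] isT.

(** * The crank *)

Definition ones (la : seq nat) : nat := count_mem 1 la.

Definition crank (la : seq nat) : int :=
  if ones la == 0 then Posz (head 0 la)
  else (Posz (count (ltn (ones la)) la) - Posz (ones la))%R.

Definition crank_count (m : int) (n : nat) : nat :=
  #|` fset_set [set la : partn | sumn la = n /\ crank la = m]%classic |.

Definition binomial_int (x : int) (j : nat) : rat :=
  ((\prod_(i < j) (x - (i : nat)%:Z)%:~R) / (j`!)%:R)%R.

(* symmetrized_crank_moment k n is $\mu_{2k}(n)$. *)
Definition symmetrized_crank_moment (k n : nat) : rat :=
  (\sum_(m \in [set: int])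
     binomial_int (m + k%:Z - 1) (2 * k) * (crank_count m n)%:R)%R.

(** * Balanced parts *)

(* Scans the parts of b in order; u is the number of unbalanced parts met
   so far. *)
Fixpoint balanced_from (a : seq nat) (u : nat) (b : seq nat) : nat :=
  if b is x :: b' then
    if count (ltn x) a == u then (balanced_from a u b').+1
    else balanced_from a u.+1 b'
  else 0.

Definition balanced (a b : seq nat) : nat := balanced_from a 0 b.

(** * Marked Dyson symbols *)

(* The two components hold the pairs (alpha^(1), beta^(1)), ...,
   (alpha^(k), beta^(k)) and the numbers p_0, ..., p_(k-1), in this order: the
   partition p is stored in increasing order, so that p_i has index i. *)
Definition symbol (k : nat) : Type :=
  (k.-tuple (partn * partn) * k.-tuple nat)%type.

Section Symbol.
Variables (k : nat) (eta : symbol k).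

(* The pairs are numbered from 1. *)
Definition alpha (i : nat) : partn :=
  (nth (empty_partn, empty_partn) eta.1 i.-1).1.
Definition beta (i : nat) : partn :=
  (nth (empty_partn, empty_partn) eta.1 i.-1).2.
Definition mark (i : nat) : nat := nth 0 eta.2 i.

(* In the last field, the largest part of an empty partition is read as
   p_(k-2), which is the lower bound for the parts of alpha^(k-1) and
   beta^(k-1). This matters only if alpha^(k-1) and beta^(k-1) are both empty,
   and then the condition says p_(k-1) = p_(k-2). *)
Record marked_Dyson : Prop := MarkedDyson {
  mark_bottom : mark 0 = 1;
  mark_mono : forall i, 1 <= i <= k - 1 -> mark i.-1 <= mark i;
  parts_between : forall i, 1 <= i <= k - 1 ->
    forall x, (x \in parts (alpha i)) || (x \in parts (beta i)) ->
    mark i.-1 <= x <= mark i;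
  last_parts_ge :
    forall x, (x \in parts (alpha k)) || (x \in parts (beta k)) ->
    mark (k - 1) <= x;
  last_alpha1 : size (alpha k) = 1 -> nth 0 (alpha k) 0 = mark (k - 1);
  last_alpha2 : size (alpha k) > 1 -> nth 0 (alpha k) 0 = nth 0 (alpha k) 1;
  last_beta1 : size (alpha k) = 0 -> size (beta k) = 1 ->
    nth 0 (beta k) 0 = mark (k - 1);
  last_beta2 : size (alpha k) = 0 -> size (beta k) >= 2 ->
    nth 0 (beta k) 0 = nth 0 (beta k) 1;
  last_empty : size (alpha k) = 0 -> size (beta k) = 0 ->
    mark (k - 1) = maxn (head (mark (k - 2)) (alpha (k - 1)))
                        (head (mark (k - 2)) (beta (k - 1))) }.

Definition symbol_balanced (i : nat) : nat :=
  if i == k then 0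
  else if size (beta i) <= size (alpha i) then balanced (alpha i) (beta i)
  else balanced (beta i) (alpha i).

Definition large_length : nat :=
  \sum_(1 <= i < k.+1) maxn (size (alpha i)) (size (beta i)).

Definition small_length : nat :=
  \sum_(1 <= i < k.+1) minn (size (alpha i)) (size (beta i)).

Definition total_balanced : nat := \sum_(1 <= i < k.+1) symbol_balanced i.

(* The subtraction small_length - total_balanced never truncates, see
   total_balanced_le. *)
Definition weight : nat :=
  \sum_(1 <= i < k.+1) (sumn (alpha i) + sumn (beta i))
  + \sum_(1 <= i < k) mark i
  + (large_length + total_balanced + k - 1) * (small_length - total_balanced).

Lemma balanced_le (a b : seq nat) : balanced a b <= size b.
Proof.
rewrite /balanced; elim: b 0 => //= x b IHb u.
by case: ifP => _; rewrite ?ltnS // (leq_trans (IHb _)).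
Qed.

Lemma total_balanced_le : total_balanced <= small_length.
Proof.
apply: leq_sum => i _; rewrite /symbol_balanced; case: ifP => // _.
by rewrite minnC; case: (leqP (size (beta i))) => _; exact: balanced_le.
Qed.

End Symbol.

Definition marked_Dyson_symbols (k n : nat) : set (symbol k) :=
  [set eta : symbol k | marked_Dyson eta /\ weight eta = n]%classic.
Arguments marked_Dyson_symbols : clear implicits.

(** * Finiteness *)

Definition partn_of (N : nat) (t : {bseq N of 'I_N.+1}) : partn :=
  insubd empty_partn (map val t).

Lemma leq_sumn (s : seq nat) (x : nat) : x \in s -> x <= sumn s.
Proof.
elim: s => //= y s IHs; rewrite inE => /predU1P[->|/IHs]; first exact: leq_addr.
by move=> le_x; apply: leq_trans le_x (leq_addl _ _).
Qed.

Lemma size_le_sumn (la : partn) : size la <= sumn la.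
Proof.
case: la => s /= /andP[_]; elim: s => //= x s IHs.
rewrite inE negb_or eq_sym -lt0n => /andP[x_gt0 /IHs].
by move=> le_s; rewrite -add1n leq_add.
Qed.

Lemma partn_of_surj (N : nat) (la : partn) :
  sumn la <= N -> exists t, partn_of (N := N) t = la.
Proof.
move=> le_laN.
have sz : size [seq (inord x : 'I_N.+1) | x <- la] <= N.
  by rewrite size_map (leq_trans (size_le_sumn la)).
exists (Bseq sz); apply: val_inj; rewrite /partn_of val_insubd /= -map_comp.
have -> : [seq (val \o (fun x => inord x : 'I_N.+1)) x | x <- la] = la.
  rewrite -[RHS]map_id; apply/eq_in_map => x x_la /=.
  by rewrite inordK // ltnS (leq_trans (leq_sumn x_la)).
by rewrite partsP.
Qed.

Lemma finite_partitions (n : nat) :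
  finite_set [set la : partn | sumn la = n]%classic.
Proof.
apply: (@sub_finite_set _ _ ([set partn_of (N := n) t | t in setT])%classic).
  move=> la /= sum_la; have [|t <-] := @partn_of_surj n la; first by rewrite sum_la.
  by exists t.
exact/finite_image/finite_finset.
Qed.

Lemma finite_crank_support (n : nat) :
  finite_set [set m : int | crank_count m n != 0]%classic.
Proof.
apply: (@sub_finite_set _ _
  ([set crank (parts la) | la in [set la : partn | sumn la = n]])%classic);
  last exact/finite_image/finite_partitions.
move=> m /=; rewrite /crank_count; apply: contra_neqP => no_la.
suff -> : [set la : partn | sumn la = n /\ crank la = m]%classic = set0
  by rewrite fset_set0.
by rewrite -subset0 => la /= [sum_la crank_la]; apply: no_la; exists la.
Qed.

Lemma finite_marked_Dyson_symbols (k n : nat) :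
  finite_set (marked_Dyson_symbols k n).
Proof.
pose N := n.+1; pose T := {bseq N of 'I_N.+1}.
pose f (u : k.-tuple (T * T) * k.-tuple 'I_N.+1) : symbol k :=
  ([tuple of [seq (partn_of x.1, partn_of x.2) | x <- u.1]],
   [tuple of [seq val x | x <- u.2]]).
apply: (@sub_finite_set _ _ ([set f u | u in setT])%classic);
  last exact/finite_image/finite_finset.
move=> [ab p] /= [[p0 _ _ _ _ _ _ _ _] wt].
have le_sum (i : 'I_k) :
    sumn (tnth ab i).1 + sumn (tnth ab i).2 <= n.
  rewrite -wt /weight -!addnA (leq_trans _ (leq_addr _ _)) //.
  rewrite big_add1 /= big_mkord (bigD1 i) //=.
  by rewrite /alpha /beta /= -!tnth_nth leq_addr.
have le_p (i : 'I_k) : tnth p i <= N.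
  rewrite (tnth_nth 0); case: (posnP i) => [-> | i_gt0].
    by move: p0; rewrite /mark /= => ->.
  apply: leqW; rewrite -wt /weight.
  rewrite (leq_trans _ (leq_addr _ _)) // (leq_trans _ (leq_addl _ _)) //.
  rewrite (bigD1_seq (i : nat)) ?iota_uniq //=; first exact: leq_addr.
  by rewrite mem_index_iota i_gt0 ltn_ord.
have /choice[g gE] (i : 'I_k) : exists t : T * T,
    (partn_of t.1, partn_of t.2) = tnth ab i.
  have le1 : sumn (tnth ab i).1 <= N.
    by apply/leqW/(leq_trans _ (le_sum i))/leq_addr.
  have le2 : sumn (tnth ab i).2 <= N.
    by apply/leqW/(leq_trans _ (le_sum i))/leq_addl.
  have [t1 t1E] := partn_of_surj le1; have [t2 t2E] := partn_of_surj le2.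
  by exists (t1, t2); rewrite /= t1E t2E -surjective_pairing.
exists ([tuple g i | i < k], [tuple inord (tnth p i) | i < k]) => //.
congr (_, _); apply: eq_from_tnth => i.
  by rewrite tnth_map tnth_mktuple gE.
by rewrite tnth_map tnth_mktuple /= inordK // ltnS.
Qed.

(* Main.v *)
Require Import Defs.
From mathcomp Require Import all_boot all_order all_algebra finmap.
From mathcomp Require Import boolp classical_sets functions cardinality fsbigop.
From mathcomp Require Import zify.

(** Both sides of the identity are expressed by the numbers [P(e, n)] of pairs
    of partitions [(a, b)] with [size b - size a = e] and
    [|a| + |b| + size a * size b = n], which satisfy [P(e, n) = P(-e, n)].

    Such a pair is a word: its parts are listed in decreasing order, the parts
    of one partition as up steps and those of the other as down steps of a
    lattice path; at equal parts the down steps come first. When the parts of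
    the longer partition are the up steps, the balanced parts of the shorter
    one are the down steps met at height 0, once these are taken not to change
    the height. Turning them into up steps gives a path that stays nonnegative.
    Conversely, a nonnegative path of final height [e] arises in this way from
    exactly one path with [b] balanced parts and final height [e - 2b], for
    every [b <= e / 2]: the steps to be turned back are the last up steps from
    the heights [0, ..., b - 1]. The two roles of the partitions of a pair make
    this [e + 1] preimages (counted_flip_pair_word).

    To a marked Dyson symbol corresponds one word, from the last pair to the
    first: the path of the last pair as it is, then each mark as an up step
    followed by the nonnegative path of the next pair. The up steps number
    [l + D + k] and the down steps [s - D], where [k] is the number of marks
    other than [p_0], so that the weight of the symbol is that of its word. In a
    word of final height [e], the last mark that is read must be the last up
    step from some height [j < e], and any such [j] occurs; hence the number
    [c_k(e)] of symbols with a given word satisfies [c_0(e) = 1 + [e > 0]] and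
    [c_(k+1)(e) = sum_(j < e) c_k(j) (e - j)], that is,
    [c_k(e) = 'C(e + k - 1, 2k) + 'C(e + k, 2k)] for [k > 0]
    (counted_symbol_word, symbol_mult_sum).

    The condition on the largest parts of the last pair forces one part, or the
    last mark, to its least possible value. Raising this value by one is a
    bijection from all symbols of weight [n - 1] to the symbols of weight [n]
    that violate the condition. So the number of marked Dyson symbols is
    [sum_e c_k(e) (P(e, n) - P(e, n - 1))] (counted_tight).

    On the other side, conjugating [a] identifies the pairs with the
    partitions of [n] in which some number [w] of the ones is selected, where
    [w = size a] (counted_crank_pair). Those in which all ones are selected are
    counted by the crank, and the others become partitions of [n - 1] when a
    one is removed, so that [M(e, n) = P(e, n) - P(e, n - 1)] (counted_crank).
    The binomial coefficients that belong to [e] and [-e] in the symmetrized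
    moment add up to [c_k(e)]. *)

Set Implicit Arguments.
Unset Strict Implicit.
Unset Printing Implicit Defensive.

(* The library also has a constant named [partn]; this restores the type of
   partitions under that name. *)
Import Defs.

(** * Counting *)

(** [counted A n] says that the predicate [A] holds for exactly [n] elements;
    a duplicate-free list of them serves as witness. *)
Definition counted (T : eqType) (A : T -> Prop) (n : nat) : Prop :=
  exists s : seq T, [/\ uniq s, forall x, x \in s <-> A x & size s = n].

Lemma counted_ext (T : eqType) (A B : T -> Prop) n :
  (forall x, A x <-> B x) -> counted A n -> counted B n.
Proof.
move=> AB [s [us sA sn]]; exists s; split=> // x.
by split=> [/sA/AB|/AB/sA].
Qed.

Lemma counted_inj (T : eqType) (A : T -> Prop) m n :
  counted A m -> counted A n -> m = n.
Proof.
move=> [s [us sA <-]] [t [ut tA <-]]; apply/perm_size/uniq_perm => // x.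
by apply/idP/idP => [/sA/tA|/tA/sA].
Qed.

Lemma counted0 (T : eqType) (A : T -> Prop) :
  (forall x, ~ A x) -> counted A 0.
Proof. by move=> A0; exists [::]; split=> // x; split=> // /A0. Qed.

Lemma counted1 (T : eqType) (A : T -> Prop) x :
  A x -> (forall y, A y -> y = x) -> counted A 1.
Proof.
move=> Ax A1; exists [:: x]; split=> // y; rewrite inE.
by split=> [/eqP->|/A1->].
Qed.

Lemma counted_image (T U : eqType) (f : T -> U)
    (A : T -> Prop) (B : U -> Prop) n :
  (forall x, A x -> B (f x)) ->
  (forall x y, A x -> A y -> f x = f y -> x = y) ->
  (forall y, B y -> exists2 x, A x & f x = y) ->
  counted A n -> counted B n.
Proof.
move=> AB finj fsurj [s [us sA <-]]; exists (map f s); rewrite size_map.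
split=> // [|y].
  by rewrite map_inj_in_uniq // => x y /sA Ax /sA Ay; apply: finj.
split=> [/mapP[x /sA Ax ->]|/fsurj[x /sA xs <-]]; first exact: AB.
by apply/mapP; exists x.
Qed.

Lemma counted_or (T : eqType) (A B : T -> Prop) m n :
  (forall x, A x -> ~ B x) ->
  counted A m -> counted B n -> counted (fun x => A x \/ B x) (m + n).
Proof.
move=> AB [s [us sA <-]] [t [ut tB <-]].
exists (s ++ t); rewrite size_cat; split=> // [|x].
  rewrite cat_uniq us ut andbT; apply/hasPn => x /tB Bx.
  by apply/negP => /sA/AB; apply.
rewrite mem_cat.
by split=> [/orP[/sA|/tB]|[/sA ->|/tB ->]]; rewrite ?orbT; [left|right| |].
Qed.

Lemma counted_prod (T U : eqType) (A : T -> Prop) (B : U -> Prop) m n :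
  counted A m -> counted B n ->
  counted (fun x => A x.1 /\ B x.2) (m * n).
Proof.
move=> [s [us sA <-]] [t [ut tB <-]].
exists [seq (x, y) | x <- s, y <- t]; rewrite size_allpairs; split=> //.
  by rewrite allpairs_uniq // => -[x y] [x' y'].
case=> x y /=; split=> [/allpairsP[[x' y'] /= [/sA Ax /tB By [-> ->]]]|] //.
by move=> [/sA xs /tB yt]; apply/allpairsP; exists (x, y).
Qed.

Lemma counted_fibre (T U : eqType) (f : T -> U) (A : T -> Prop)
    (r : seq U) (c : U -> nat) :
  uniq r -> (forall x, A x -> f x \in r) ->
  (forall y, y \in r -> counted (fun x => A x /\ f x = y) (c y)) ->
  counted A (\sum_(y <- r) c y).
Proof.
move=> ur Ar cnt.
apply: (@counted_ext _ (fun x => A x /\ f x \in r)) => [x|].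
  by split=> [[]|Ax] //; split=> //; apply: Ar.
elim: r ur {Ar} cnt => /= [_ _|y r IHr /andP[yr ur] cnt].
  by rewrite big_nil; apply: counted0 => x [].
rewrite big_cons.
apply: (@counted_ext _ (fun x => (A x /\ f x = y) \/ (A x /\ f x \in r))).
  move=> x; rewrite inE; split=> [[[Ax ->]|[Ax ->]]|[Ax /orP[/eqP|]]].
  - by rewrite eqxx.
  - by rewrite orbT.
  - by left.
  - by right.
apply: counted_or.
- by move=> x [_ ->] [_]; rewrite (negPf yr).
- by apply: cnt; rewrite inE eqxx.
- by apply: IHr => // z zr; apply: cnt; rewrite inE zr orbT.
Qed.

Lemma counted_fibre_const (T U : eqType) (f : T -> U) (A : T -> Prop)
    (B : U -> Prop) n c :
  counted B n -> (forall x, A x -> B (f x)) ->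
  (forall y, B y -> counted (fun x => A x /\ f x = y) c) ->
  counted A (c * n).
Proof.
move=> [s [us sB <-]] AB cnt; rewrite mulnC.
rewrite -(count_predT s) -sum1_count big_distrl /=.
under eq_bigr do rewrite mul1n.
apply: (counted_fibre (f := f)) => // [x /AB/sB //|y /sB]; exact: cnt.
Qed.

Lemma counted_preimage (T U : eqType) (f : T -> U)
    (A : T -> Prop) (B : U -> Prop) n :
  (forall x, A x -> B (f x)) ->
  (forall x y, A x -> A y -> f x = f y -> x = y) ->
  (forall y, B y -> exists2 x, A x & f x = y) ->
  counted B n -> counted A n.
Proof.
move=> AB finj fsurj cB; rewrite -[n]mul1n.
apply: (counted_fibre_const cB AB) => y /fsurj[x Ax fxy].
by apply: (@counted1 _ _ x) => // x' [Ax' fx'y]; apply: finj; rewrite ?fxy.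
Qed.

Lemma card_counted (T : choiceType) (A : set T) :
  finite_set A -> counted A #|` fset_set A|.
Proof.
move=> finA; exists (enum_fset (fset_set A)); split=> // x.
split=> [xA|/mem_set]; last by rewrite -in_fset_set.
by apply/set_mem; rewrite -in_fset_set.
Qed.

(** * Words *)

(** A letter is a part together with a direction, up ([true]) or down
    ([false]). *)
Definition letter : Type := (nat * bool)%type.

(** Words list their letters by decreasing part, and at equal parts the down
    letters come before the up letters: a part of the shorter partition is
    balanced or not according to the strictly larger parts of the longer. *)
Definition letter_le (x y : letter) : bool :=
  (y.1 < x.1) || (x.1 == y.1) && (x.2 ==> y.2).

Fixpoint ups (z : seq letter) : seq nat :=
  if z is (x, b) :: z' then if b then x :: ups z' else ups z' else [::].

Fixpoint downs (z : seq letter) : seq nat :=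
  if z is (x, b) :: z' then if b then downs z' else x :: downs z' else [::].

(** The word whose up parts are [a] and whose down parts are [b]. *)
Definition word (a b : seq nat) : seq letter :=
  sort letter_le ([seq (x, true) | x <- a] ++ [seq (x, false) | x <- b]).

Definition is_partn (s : seq nat) : bool := sorted geq s && (0 \notin s).
Definition is_word (z : seq letter) : bool :=
  sorted letter_le z && (0 \notin map fst z).

Lemma letter_le_total : total letter_le.
Proof. by case=> x [] [y []]; rewrite /letter_le /=; lia. Qed.

Lemma letter_le_trans : transitive letter_le.
Proof. by case=> x [] [y []] [z []]; rewrite /letter_le /=; lia. Qed.

Lemma letter_le_anti : antisymmetric letter_le.
Proof. by case=> x [] [y []]; rewrite /letter_le /= => ?; congr (_, _); lia. Qed.

Lemma geq_trans : transitive geq.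
Proof. by move=> y x z /= yx zy; apply: leq_trans zy yx. Qed.

Lemma upsE z : ups z = [seq x.1 | x <- z & x.2].
Proof. by elim: z => [|[x []] z /= ->]. Qed.

Lemma downsE z : downs z = [seq x.1 | x <- z & ~~ x.2].
Proof. by elim: z => [|[x []] z /= ->]. Qed.

Lemma ups_cat z1 z2 : ups (z1 ++ z2) = ups z1 ++ ups z2.
Proof. by rewrite !upsE filter_cat map_cat. Qed.

Lemma downs_cat z1 z2 : downs (z1 ++ z2) = downs z1 ++ downs z2.
Proof. by rewrite !downsE filter_cat map_cat. Qed.

Lemma perm_ups_downs z : perm_eq (ups z ++ downs z) (map fst z).
Proof. by rewrite upsE downsE -map_cat; apply/perm_map/permEl/perm_filterC. Qed.

Lemma word_ups a b : sorted geq a -> ups (word a b) = a.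
Proof.
move=> sa; rewrite upsE filter_sort; [|exact: letter_le_total|exact: letter_le_trans].
rewrite filter_cat !filter_map /preim /= filter_predT filter_pred0 cats0.
rewrite sorted_sort; [|exact: letter_le_trans|].
  by rewrite -map_comp map_id.
rewrite sorted_map; apply: sub_sorted sa => x y /=.
by rewrite /letter_le /=; lia.
Qed.

Lemma word_downs a b : sorted geq b -> downs (word a b) = b.
Proof.
move=> sb; rewrite downsE filter_sort; [|exact: letter_le_total|exact: letter_le_trans].
rewrite filter_cat !filter_map /preim /= filter_predT filter_pred0 cat0s.
rewrite sorted_sort; [|exact: letter_le_trans|].
  by rewrite -map_comp map_id.
rewrite sorted_map; apply: sub_sorted sb => x y /=.
by rewrite /letter_le /=; lia.
Qed.

Lemma word_ups_downs z : sorted letter_le z -> word (ups z) (downs z) = z.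
Proof.
move=> sz; apply: (sorted_eq letter_le_trans letter_le_anti) => //.
  exact/sort_sorted/letter_le_total.
rewrite perm_sort upsE downsE -!map_comp.
have -> : [seq ((fun x => (x, true)) \o fst) i | i <- z & i.2] = [seq i <- z | i.2].
  by rewrite -[RHS]map_id; apply/eq_in_map => -[x b]; rewrite mem_filter /= => /andP[->].
have -> : [seq ((fun x => (x, false)) \o fst) i | i <- z & ~~ i.2] =
    [seq i <- z | ~~ i.2].
  rewrite -[RHS]map_id; apply/eq_in_map => -[x b].
  by rewrite mem_filter /= => /andP[/negPf->].
by apply/permEl/perm_filterC.
Qed.

Lemma sorted_word_fst z : sorted letter_le z -> sorted geq (map fst z).
Proof.
rewrite sorted_map; apply: sub_sorted => -[x b] [y c].
by rewrite /letter_le /=; lia.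
Qed.

Lemma is_word_partn z : is_word z -> is_partn (ups z) /\ is_partn (downs z).
Proof.
move=> /andP[sz z0]; rewrite /is_partn.
have ud0 : 0 \notin ups z ++ downs z by rewrite (perm_mem (perm_ups_downs z)).
have [u0 d0] : 0 \notin ups z /\ 0 \notin downs z.
  by move: ud0; rewrite mem_cat negb_or => /andP[].
by rewrite u0 d0 upsE downsE !andbT; split; apply/sorted_word_fst/sorted_filter => //;
  exact: letter_le_trans.
Qed.

Lemma perm_word a b : perm_eq (map fst (word a b)) (a ++ b).
Proof.
apply: (perm_trans (perm_map _ (permEl (perm_sort _ _)))).
by rewrite map_cat -!map_comp !map_id.
Qed.

Lemma word_is_word a b : is_partn a -> is_partn b -> is_word (word a b).
Proof.
move=> /andP[_ a0] /andP[_ b0]; apply/andP; split.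
  exact/sort_sorted/letter_le_total.
by rewrite (perm_mem (perm_word _ _)) mem_cat negb_or a0.
Qed.

(** * Balanced parts as steps of a lattice path *)

(** A word is read as a lattice path with steps +1 (up) and -1 (down).
    [nonneg h z] says that the path started at height [h] stays at or above
    0. *)
Fixpoint nonneg (h : nat) (z : seq letter) : bool :=
  match z with
  | [::] => true
  | (_, true) :: z' => nonneg h.+1 z'
  | (_, false) :: z' => if h is h'.+1 then nonneg h' z' else false
  end.

(** The number of balanced letters, when the path starts at height [h]: these
    are the down steps met at height 0, and they leave the height unchanged. *)
Fixpoint bal (h : nat) (z : seq letter) : nat :=
  match z with
  | [::] => 0
  | (_, true) :: z' => bal h.+1 z'
  | (_, false) :: z' => if h is h'.+1 then bal h' z' else (bal 0 z').+1
  end.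

(** Turns the balanced letters into up letters. *)
Fixpoint flip (h : nat) (z : seq letter) : seq letter :=
  match z with
  | [::] => [::]
  | (x, true) :: z' => (x, true) :: flip h.+1 z'
  | (x, false) :: z' =>
      if h is h'.+1 then (x, false) :: flip h' z' else (x, true) :: flip 0 z'
  end.

Lemma size_ups_flip h z : size (ups (flip h z)) = size (ups z) + bal h z.
Proof.
by elim: z h => [|[x []] z IHz] [|h] //=; rewrite IHz ?addnS.
Qed.

Lemma size_downs_flip h z : size (downs (flip h z)) + bal h z = size (downs z).
Proof.
by elim: z h => [|[x []] z IHz] [|h] //=; rewrite ?addnS ?addSn IHz.
Qed.

Lemma map_fst_flip h z : map fst (flip h z) = map fst z.
Proof. by elim: z h => [|[x []] z IHz] [|h] //=; rewrite IHz. Qed.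

Lemma nonneg_weaken h h' z : h <= h' -> nonneg h z -> nonneg h' z.
Proof.
elim: z h h' => [|[x []] z IHz] [|h] [|h'] //= le; try exact: IHz.
Qed.

Lemma nonneg_flip h z : nonneg h (flip h z).
Proof.
elim: z h => [|[x []] z IHz] [|h] //=.
exact: nonneg_weaken (IHz 0).
Qed.

Lemma nonneg_cat_le h z1 z2 :
  nonneg h (z1 ++ z2) -> size (downs z1) <= h + size (ups z1).
Proof.
elim: z1 h => [|[x []] z1 IHz] [|h] //= /IHz; lia.
Qed.

Lemma nonneg_le h z : nonneg h z -> size (downs z) <= h + size (ups z).
Proof. by rewrite -{1}[z]cats0; apply: nonneg_cat_le. Qed.

Lemma nonneg_rcons h z x b :
  nonneg h (rcons z (x, b)) =
  nonneg h z && (b || (size (downs z) < h + size (ups z))).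
Proof.
elim: z h => [|[y []] z IHz] [|h] /=; rewrite ?andbT ?IHz //=; do ?by case: b.
all: rewrite -/(ups _) -/(downs _).
all: by rewrite -?addSnnS ?add0n.
Qed.

(** After a flipped letter the height is 0, so that an adjacent down letter is
    flipped too: flipping neither creates nor removes a violation of the order
    of letters. *)
Lemma path_flip h l l' z :
  l.1 = l'.1 -> (l.2 == l'.2) || ((h == 0) && l'.2) ->
  ~~ (l.2 && (h == 0)) ->
  path letter_le l z = path letter_le l' (flip h z).
Proof.
elim: z h l l' => [|[x b] z IHz] h [u c] [u' c'] //= <- {u'} cc' ch.
case: b => /=.
  rewrite -(IHz _ (x, true) (x, true)) //= /letter_le /=; congr andb.
  by rewrite !implybT.
case: h => [|h] /= in cc' ch *.
  rewrite -(IHz _ (x, false) (x, true)) //= /letter_le /=; congr andb.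
  by rewrite !implybT; case: c ch {cc'}.
rewrite orbF in cc'; rewrite -(eqP cc').
rewrite -(IHz _ (x, false) (x, false)) //=.
Qed.

Lemma sorted_flip z : sorted letter_le (flip 0 z) = sorted letter_le z.
Proof.
case: z => [|[x []] z] //=.
  by rewrite -(path_flip (l := (x, true))).
by rewrite -(path_flip (l := (x, false))).
Qed.

Lemma is_word_flip z : is_word (flip 0 z) = is_word z.
Proof. by rewrite /is_word sorted_flip map_fst_flip. Qed.

(** When two words have the same image, that of larger starting height keeps
    the larger height to the end: only at height 0 can its gap to the other
    shrink, and there the other would be below 0. *)
Lemma flip_eq_bal h1 h2 y1 y2 :
  flip h1 y1 = flip h2 y2 -> h1 < h2 -> bal h2 y2 + h1 < bal h1 y1 + h2.
Proof.
elim: y1 y2 h1 h2 => [|[x1 b1] y1 IHy] [|[x2 b2] y2] h1 h2 //=.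
- by case: b2; case: h2.
- by case: b1; case: h1.
case: b1 b2 => -[]; case: h1 h2 => [|h1] [|h2] //= -[_] /IHy IH lt_h;
  try (by have := IH lt_h; lia); try (by have := IH isT; lia);
  by have := IH (ltnW lt_h); lia.
Qed.

Lemma flip_inj h y1 y2 :
  flip h y1 = flip h y2 -> bal h y1 = bal h y2 -> y1 = y2.
Proof.
elim: y1 y2 h => [|[x1 b1] y1 IHy] [|[x2 b2] y2] h //=.
- by case: b2; case: h.
- by case: b1; case: h.
case: b1 b2 => -[]; case: h => [|h] //= -[<-].
- by move=> /IHy IH /IH->.
- by move=> /IHy IH /IH->.
- by move=> /esym /flip_eq_bal/(_ isT); lia.
- by move=> /flip_eq_bal/(_ isT); lia.
- by move=> /IHy IH [/IH->].
- by move=> /IHy IH /IH->.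
Qed.

(** The letters to be flipped back are the last up steps from the heights 0,
    ..., [b - 1]. When [h] is positive this requires the path to come back to
    height 0. *)
Lemma flip_surj h b z :
  nonneg h z -> size (downs z) + b <= h + size (ups z) ->
  (b == 0) || (h == 0) || ~~ nonneg h.-1 z ->
  exists2 y, flip h y = z & bal h y = b.
Proof.
elim: z h b => [|[x c] z IHz] h b /=.
  by case: h => [|h] _ le_b b0; exists [::] => //=; lia.
case: c => /= [nn le_b ok|].
  have le_b' : size (downs z) + b <= h.+1 + size (ups z) by lia.
  (* An up step from height 0 is flipped back exactly when the path does not
     return to height 0 and flips are still to be made. *)
  have [nn0|not_nn0] := boolP (nonneg h z).
    case: h b => [|h] [|b] in nn le_b ok le_b' nn0 *.
    - have [//|//|//|y yz yb] := IHz 1 0.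
      by exists ((x, true) :: y); rewrite /= ?yz ?yb.
    - have [||y yz yb] := IHz 0 b nn0; [lia|by rewrite orbT|].
      by exists ((x, false) :: y); rewrite /= ?yz ?yb.
    - have [//|//|//|y yz yb] := IHz h.+2 0.
      by exists ((x, true) :: y); rewrite /= ?yz ?yb.
    - by rewrite /= nn0 in ok.
  have [//|//||y yz yb] := IHz h.+1 b; first by rewrite not_nn0 orbT.
  by exists ((x, true) :: y); rewrite /= ?yz ?yb.
case: h => [//|h] nn le_b ok; have [//|||y yz yb] := IHz h b; first by lia.
  by case: h ok nn le_b => [|h] //= *; rewrite orbT.
by exists ((x, false) :: y); rewrite /= ?yz ?yb.
Qed.

(** * The last passage decomposition *)

(** [z1] follows the last up step from height [j]. *)
Lemma last_passage e j z :
  size (ups z) = size (downs z) + e -> j < e ->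
  exists z2 p z1, [/\ z = z2 ++ (p, true) :: z1, nonneg 0 z1 &
                      size (ups z2) = size (downs z2) + j].
Proof.
elim/last_ind: z e => [|z [x c] IHz] e /=; first by lia.
rewrite -cats1 ups_cat downs_cat !size_cat /=; case: c => /= ez lt_j.
  have [lt_j'|le_j] := ltnP j e.-1.
    have [|z2 [p [z1 [-> nn z2j]]]] := IHz e.-1 _ lt_j'; first by lia.
    exists z2, p, (rcons z1 (x, true)); split=> //.
      by rewrite cats1 rcons_cat.
    by rewrite nonneg_rcons nn.
  by exists z, x, [::]; split=> //; lia.
have [|z2 [p [z1 [zE nn z2j]]]] := IHz e.+1 _ (leqW lt_j); first by lia.
exists z2, p, (rcons z1 (x, false)); split=> //.
  by rewrite zE cats1 rcons_cat.
rewrite nonneg_rcons nn /=.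
by move: ez; rewrite zE ups_cat downs_cat !size_cat /=; lia.
Qed.

Lemma last_passage_uniq z2 p z1 z2' p' z1' :
  z2 ++ (p, true) :: z1 = z2' ++ (p', true) :: z1' ->
  nonneg 0 z1 -> nonneg 0 z1' ->
  size (ups z2) + size (downs z2') = size (ups z2') + size (downs z2) ->
  [/\ z2 = z2', p = p' & z1 = z1'].
Proof.
elim: z2 z2' => [|l z2 IHz] [|l' z2'] //=.
- by move=> [-> ->].
- move=> [<- ->] /= /nonneg_cat_le; rewrite add0n; lia.
- case: l => x b [-> -> <-] /= _ /nonneg_cat_le; rewrite add0n; lia.
move=> [<-] zE nn nn'; case: l => x [] /= sz;
  by have [|-> -> ->] := IHz _ zE nn nn'; first lia.
Qed.

(** * Pairs of partitions *)

Lemma mem_ups z x : (x \in ups z) = ((x, true) \in z).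
Proof.
rewrite upsE; apply/mapP/idP => [[[y b] /=]|xz].
  by rewrite mem_filter /= => /andP[-> yz] ->.
by exists (x, true); rewrite ?mem_filter.
Qed.

Lemma mem_downs z x : (x \in downs z) = ((x, false) \in z).
Proof.
rewrite downsE; apply/mapP/idP => [[[y b] /=]|xz].
  by rewrite mem_filter /= => /andP[/negPf-> yz] ->.
by exists (x, false); rewrite ?mem_filter.
Qed.

(** The height of the path counts the up parts met so far, less the unbalanced
    down parts: it vanishes exactly at the balanced parts. *)
Lemma balanced_from_bal z a u :
  sorted letter_le z -> {in downs z, forall x, all (ltn x) a} -> u <= size a ->
  balanced_from (a ++ ups z) u (downs z) = bal (size a - u) z.
Proof.
elim: z a u => [|[x b] z IHz] a u //= pz az le_u.
have sz := path_sorted pz.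
have xz := order_path_min letter_le_trans pz.
case: b => /= in pz az xz *.
  rewrite -cat_rcons IHz ?size_rcons ?leqW ?subSn // => y yz.
  rewrite all_rcons az // andbT /=.
  by rewrite mem_downs in yz; move: (allP xz _ yz); rewrite /letter_le /=; lia.
have -> : count (ltn x) (a ++ ups z) = size a.
  rewrite count_cat; have := az x (mem_head _ _); rewrite all_count => /eqP->.
  rewrite -[RHS]addn0; congr addn; apply/eqP; rewrite -leqn0 leqNgt -has_count.
  apply/hasPn => y; rewrite mem_ups => /(allP xz).
  by rewrite /letter_le /=; lia.
have az' : {in downs z, forall y, all (ltn y) a}.
  by move=> y yz; apply: az; rewrite inE yz orbT.
case: eqP => [ua|/eqP ua]; rewrite IHz //.
- by rewrite -ua subnn.
- by have -> : size a - u = (size a - u.+1).+1 by lia.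
- by lia.
Qed.

Lemma balanced_word (a b : seq nat) :
  sorted geq a -> sorted geq b -> balanced a b = bal 0 (word a b).
Proof.
move=> sa sb; rewrite -(@balanced_from_bal _ [::] 0) //=.
  by rewrite word_ups // word_downs.
exact/sort_sorted/letter_le_total.
Qed.

(** The word of a pair of partitions, the longer of which gives the up
    letters. *)
Definition pair_word (ab : partn * partn) : seq letter :=
  if size ab.2 <= size ab.1 then word ab.1 ab.2 else word ab.2 ab.1.

Lemma partn_exists s : is_partn s -> exists la : partn, parts la = s.
Proof. by move=> sP; exists (Partn sP). Qed.

Lemma partn_sorted (la : partn) : sorted geq la.
Proof. by have /andP[] := partsP la. Qed.

Lemma pair_word_is_word ab : is_word (pair_word ab).
Proof.
by rewrite /pair_word; case: ifP => _; apply: word_is_word; exact: partsP.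
Qed.

Lemma pair_word_ups ab :
  size (ups (pair_word ab)) = maxn (size ab.1) (size ab.2).
Proof.
rewrite /pair_word; case: leqP => _; rewrite word_ups //; exact: partn_sorted.
Qed.

Lemma pair_word_downs ab :
  size (downs (pair_word ab)) = minn (size ab.1) (size ab.2).
Proof.
rewrite /pair_word minnC; case: leqP => _; rewrite word_downs //;
  exact: partn_sorted.
Qed.

Lemma perm_pair_word ab : perm_eq (map fst (pair_word ab)) (ab.1 ++ ab.2).
Proof.
rewrite /pair_word; case: ifP => _; rewrite (permPl (perm_word _ _)) //.
by rewrite perm_catC.
Qed.

(** The pairs with a given word fall into those whose first partition is at
    least as long as the second, and those whose second is strictly longer. *)
Lemma counted_pair_word (Y : seq letter -> Prop) m n :
  (forall y, Y y -> is_word y) ->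
  counted (fun y => Y y /\ size (downs y) <= size (ups y)) m ->
  counted (fun y => Y y /\ size (downs y) < size (ups y)) n ->
  counted (fun ab => Y (pair_word ab)) (m + n).
Proof.
move=> Yw cm cn.
apply: (@counted_ext _ (fun ab => (Y (pair_word ab) /\ size ab.2 <= size ab.1) \/
    (Y (pair_word ab) /\ size ab.1 < size ab.2))) => [ab|].
  by case: (leqP (size ab.2)); intuition.
have sP := partn_sorted.
apply: counted_or => [ab [_ le] [_]||]; first by rewrite ltnNge le.
- apply: (counted_preimage (f := fun ab : partn * partn => word ab.1 ab.2)) cm.
  + move=> ab [Yab le]; rewrite word_ups // word_downs //.
    by move: Yab; rewrite /pair_word le.
  + move=> [a b] [a' b'] /= _ _ E; congr (_, _); apply: val_inj => /=.
      by rewrite -(word_ups b (sP a)) E word_ups.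
    by rewrite -(word_downs a (sP b)) E word_downs.
  + move=> y [Yy le]; have yw := Yw _ Yy; have /andP[sy _] := yw.
    have [/partn_exists[a aE] /partn_exists[b bE]] := is_word_partn yw.
    exists (a, b); rewrite /= ?aE ?bE ?word_ups_downs //.
    by rewrite /pair_word /= aE bE le word_ups_downs.
- apply: (counted_preimage (f := fun ab : partn * partn => word ab.2 ab.1)) cn.
  + move=> ab [Yab lt]; rewrite word_ups // word_downs //.
    by move: Yab; rewrite /pair_word leqNgt lt.
  + move=> [a b] [a' b'] /= _ _ E; congr (_, _); apply: val_inj => /=.
      by rewrite -(word_downs b (sP a)) E word_downs.
    by rewrite -(word_ups a (sP b)) E word_ups.
  + move=> y [Yy lt]; have yw := Yw _ Yy; have /andP[sy _] := yw.
    have [/partn_exists[b bE] /partn_exists[a aE]] := is_word_partn yw.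
    exists (a, b); rewrite /= ?aE ?bE ?word_ups_downs //.
    by rewrite /pair_word /= aE bE leqNgt lt word_ups_downs.
Qed.

Lemma counted_pair_word_eq z e :
  is_word z -> size (ups z) = size (downs z) + e ->
  counted (fun ab => pair_word ab = z) (1 + (0 < e)).
Proof.
move=> zw ze; apply: (counted_pair_word (Y := eq^~ z)) => [y ->||] //.
- by apply: (counted1 (x := z)) => [|y []//]; split=> //; lia.
- case: ltnP => e0; first by apply: (counted1 (x := z)) => [|y []//]; split=> //; lia.
  by apply: counted0 => y [->]; lia.
Qed.

Lemma counted_flip z n :
  nonneg 0 z -> size (downs z) + n <= (size (ups z)).+1 ->
  counted (fun y => flip 0 y = z /\ bal 0 y < n) n.
Proof.
move=> nn le_n; rewrite -[X in counted _ X](size_iota 0) -sum1_size.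
apply: (counted_fibre (f := bal 0)); first exact: iota_uniq.
  by move=> y [_ lt]; rewrite mem_iota.
move=> b; rewrite mem_iota /= => lt_b.
have [||y yz yb] := flip_surj nn (b := b); [lia|by rewrite orbT|].
apply: (counted1 (x := y)); first by rewrite yz yb.
by move=> y' [[yz' _] yb']; apply: (@flip_inj 0); rewrite ?yz ?yb.
Qed.

(** Turning the balanced parts into up letters is [e + 1] to one on pairs of
    partitions, where [e] is the final height of the resulting path. *)
Lemma counted_flip_pair_word z e :
  is_word z -> nonneg 0 z -> size (ups z) = size (downs z) + e ->
  counted (fun ab => flip 0 (pair_word ab) = z) e.+1.
Proof.
move=> zw nn ze.
have -> : e.+1 = e./2.+1 + uphalf e by lia.
apply: (counted_pair_word (Y := fun y => flip 0 y = z)).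
- by move=> y yz; rewrite -is_word_flip yz.
- apply: counted_ext (counted_flip (n := e./2.+1) nn _); last by lia.
  move=> y; split=> -[yz b]; split=> //; move: b;
    have := size_ups_flip 0 y; have := size_downs_flip 0 y; rewrite yz; lia.
- apply: counted_ext (counted_flip (n := uphalf e) nn _); last by lia.
  move=> y; split=> -[yz b]; split=> //; move: b;
    have := size_ups_flip 0 y; have := size_downs_flip 0 y; rewrite yz; lia.
Qed.

(** * Symbols without the condition on the last pair *)

(** A segment is a mark [p_i] together with the pair of partitions whose parts
    it bounds from above. A symbol is the list of its segments, by increasing
    index, followed by its last pair, and the mark [p_0] is a parameter [c]. *)
Definition segment : Type := (nat * (partn * partn))%type.

Definition pair_parts (ab : partn * partn) : seq nat := ab.1 ++ ab.2.

Definition segment_le (s t : segment) : bool :=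
  (s.1 <= t.1) && all (fun x => s.1 <= x <= t.1) (pair_parts t.2).

Definition is_symbol (c : nat) (l : seq segment) (ab : partn * partn) : bool :=
  path segment_le (c, (empty_partn, empty_partn)) l &&
  all (leq (last c (map fst l))) (pair_parts ab).

(** The word of a symbol: the marks and the balanced parts become up
    letters. *)
Fixpoint symbol_word (l : seq segment) (ab : partn * partn) : seq letter :=
  if l is (p, cd) :: l' then
    symbol_word l' ab ++ (p, true) :: flip 0 (pair_word cd)
  else pair_word ab.

Lemma is_symbol_cons c p cd l ab :
  is_symbol c ((p, cd) :: l) ab =
  [&& c <= p, all (fun x => c <= x <= p) (pair_parts cd) & is_symbol p l ab].
Proof.
rewrite /is_symbol /= -!andbA; congr [&& _, _ & _ && _].
by case: l => //= -[q ef] l.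
Qed.

Lemma symbol_word_ups_ge l ab :
  size (downs (symbol_word l ab)) <= size (ups (symbol_word l ab)).
Proof.
elim: l => [|[p cd] l IHl] /=.
  by rewrite pair_word_ups pair_word_downs geq_min leq_max leqnn.
rewrite ups_cat downs_cat !size_cat /=.
by have := nonneg_le (nonneg_flip 0 (pair_word cd)); lia.
Qed.

Lemma symbol_word_is_word c l ab :
  0 < c -> is_symbol c l ab ->
  is_word (symbol_word l ab) /\ all (leq c) (map fst (symbol_word l ab)).
Proof.
elim: l c => [|[p cd] l IHl] c c0.
  move=> /= lab; rewrite (perm_all _ (perm_pair_word ab)).
  by split; [exact: pair_word_is_word|].
rewrite is_symbol_cons => /and3P[cp cdP lP].
have [/andP[sw _] pw] := IHl p (leq_trans c0 cp) lP.
set w := symbol_word l ab in sw pw *; set z := flip 0 (pair_word cd).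
have zw : is_word z by rewrite is_word_flip pair_word_is_word.
have zb : all (fun x => c <= x <= p) (map fst z).
  by rewrite map_fst_flip (perm_all _ (perm_pair_word cd)).
have /andP[sz z0] := zw.
have cw : all (leq c) (map fst (w ++ (p, true) :: z)).
  rewrite map_cat all_cat /= cp /=; apply/andP; split.
    by apply: sub_all pw => x; apply: leq_trans.
  by apply: sub_all zb => x /andP[].
split=> //; rewrite /is_word; apply/andP; split; last first.
  by apply/negP => /(allP cw); rewrite leqNgt c0.
(* A nonnegative path begins with an up letter, so that no down letter [p] can
   follow the up letter of the mark. *)
have pz : path letter_le (p, true) z.
  have : nonneg 0 z by exact: nonneg_flip.
  case: z {zw cw z0} sz zb => [|[x []] z'] //= -> /andP[/andP[_ le_xp] _] _.
  by rewrite /letter_le /= !andbT orbC (eq_sym p) -leq_eqVlt.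
have ptz := order_path_min letter_le_trans pz.
rewrite !(sorted_pairwise letter_le_trans) in sw sz *.
rewrite pairwise_cat sw pairwise_cons ptz sz !andbT allrel_consr.
have wpt : all (letter_le^~ (p, true)) w.
  rewrite all_map in pw; apply: sub_all pw => -[x b].
  by rewrite /letter_le /=; clear; lia.
rewrite wpt /=; apply/allrelP => x y xw yz.
exact: letter_le_trans (allP wpt _ xw) (allP ptz _ yz).
Qed.

(** The number of symbols with [k] segments and a given word, as a function of
    the final height [e] of that word. *)
Fixpoint symbol_mult (k e : nat) : nat :=
  if k is k'.+1 then \sum_(0 <= j < e) symbol_mult k' j * (e - j)
  else 1 + (0 < e).

(** A word that comes from [k.+1] segments splits at the mark read last, which
    is the last up step from some height [j]: before it stands the word of a
    symbol with [k] segments, after it the path of a single pair. *)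
Lemma counted_symbol_word k c z e :
  is_word z -> all (leq c) (map fst z) -> size (ups z) = size (downs z) + e ->
  counted (fun eta : seq segment * (partn * partn) =>
    [/\ size eta.1 = k, is_symbol c eta.1 eta.2 & symbol_word eta.1 eta.2 = z])
    (symbol_mult k e).
Proof.
elim: k c z e => [|k IHk] c z e zw cz ze /=.
  apply: (counted_image (f := fun ab => ([::], ab))) (counted_pair_word_eq zw ze).
  - move=> ab abz; split=> //.
    by rewrite /is_symbol /= -(perm_all _ (perm_pair_word ab)) abz.
  - by move=> ab cd _ _ [].
  - by case=> [[|s l] ab] /= [lk _ abz] //; exists ab.
pose f (eta : seq segment * (partn * partn)) :=
  let w := symbol_word (behead eta.1) eta.2 in size (ups w) - size (downs w).
apply: (counted_fibre (f := f)); first exact: iota_uniq.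
  case=> [[|[p cd] l] ab] [//= _ _ zE]; rewrite mem_index_iota /f /=.
  have := symbol_word_ups_ge l ab.
  have := nonneg_le (nonneg_flip 0 (pair_word cd)).
  by move: ze; rewrite -zE ups_cat downs_cat !size_cat /=; lia.
move=> j; rewrite mem_index_iota /= => lt_je.
have [z2 [p [z1 [zE nn z2j]]]] := last_passage ze lt_je.
have /andP[sz z0] := zw; rewrite zE in sz z0 cz.
have szp := sz; rewrite (sorted_pairwise letter_le_trans) pairwise_cat in szp.
have /and3P[/allrelP z2z1 sz2 /=/andP[/allP pz1 sz1]] := szp.
rewrite -!(sorted_pairwise letter_le_trans) in sz1 sz2.
rewrite map_cat /= mem_cat inE !negb_or in z0; have /and3P[z20 p0 z10] := z0.
rewrite map_cat /= all_cat /= in cz; have /and3P[cz2 cp cz1] := cz.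
have z2w : is_word z2 by rewrite /is_word sz2.
have z1w : is_word z1 by rewrite /is_word sz1.
have pz2 : all (leq p) (map fst z2).
  apply/allP => _ /mapP[[x b] xz2 ->].
  by have := z2z1 _ _ xz2 (mem_head _ _); rewrite /letter_le /=; clear; lia.
have z1p : all (fun x => c <= x <= p) (map fst z1).
  apply/allP => x xz1; rewrite (allP cz1) //=.
  by case/mapP: xz1 => -[y b] /pz1; rewrite /letter_le /= => + ->; clear; lia.
have z1e : size (ups z1) = size (downs z1) + (e - j.+1).
  move: (nonneg_le nn) ze z2j lt_je.
  by rewrite zE ups_cat downs_cat !size_cat /=; clear; lia.
have -> : e - j = (e - j.+1).+1 by rewrite subnSK.
have := counted_prod (IHk p z2 j z2w pz2 z2j) (counted_flip_pair_word z1w nn z1e).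
apply: (counted_image (f := fun x => ((p, x.2) :: x.1.1, x.1.2))).
- case=> -[l ab] cd [/= [lk lP wz2] cdz1]; split; last first.
    by rewrite /f /= wz2 z2j addKn.
  split; [by rewrite lk| |by rewrite wz2 cdz1 zE].
  rewrite is_symbol_cons cp lP -(perm_all _ (perm_pair_word cd)).
  by rewrite -(map_fst_flip 0) cdz1 z1p.
- by case=> -[l ab] cd [[l' ab'] cd'] _ _ [-> -> ->].
case=> [[|[q cd] l] ab] [[//= [lk] + wz]]; rewrite is_symbol_cons /f /= => lP wj.
rewrite zE in wz.
have [|w2 qp w1] := last_passage_uniq wz (nonneg_flip _ _) nn.
  by move: (symbol_word_ups_ge l ab) wj z2j; clear; lia.
exists ((l, ab), cd); rewrite /= -?qp //.
by case/and3P: lP => _ _ lP; split.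
Qed.

(** * The weight of a symbol *)

(** The weight of a pair with up parts and down parts as in [z]: this is also
    the weight of every symbol with word [z]. *)
Definition word_weight (z : seq letter) : nat :=
  sumn (map fst z) + size (ups z) * size (downs z).

(** The number of balanced parts of a pair, see [pair_balancedE]. *)
Definition pair_balanced (ab : partn * partn) : nat := bal 0 (pair_word ab).

Lemma sumn_perm (s t : seq nat) : perm_eq s t -> sumn s = sumn t.
Proof. by rewrite !sumnE => st; apply: perm_big. Qed.

Lemma sumn_pair_word ab :
  sumn (map fst (pair_word ab)) = sumn ab.1 + sumn ab.2.
Proof. by rewrite (sumn_perm (perm_pair_word ab)) sumn_cat. Qed.

Lemma sumn_symbol_word l ab :
  sumn (map fst (symbol_word l ab)) =
  \sum_(s <- l) (sumn s.2.1 + sumn s.2.2) + (sumn ab.1 + sumn ab.2) +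
  \sum_(s <- l) s.1.
Proof.
elim: l => [|[p cd] l IHl] /=; first by rewrite !big_nil sumn_pair_word addn0.
rewrite map_cat sumn_cat /= map_fst_flip sumn_pair_word IHl !big_cons /=; lia.
Qed.

Lemma size_ups_symbol_word l ab :
  size (ups (symbol_word l ab)) =
  \sum_(s <- l) maxn (size s.2.1) (size s.2.2) + maxn (size ab.1) (size ab.2) +
  \sum_(s <- l) pair_balanced s.2 + size l.
Proof.
elim: l => [|[p cd] l IHl] /=; first by rewrite !big_nil pair_word_ups !addn0.
rewrite ups_cat size_cat /= size_ups_flip pair_word_ups IHl !big_cons /=.
rewrite -/(pair_balanced cd); lia.
Qed.

Lemma size_downs_symbol_word l ab :
  size (downs (symbol_word l ab)) + \sum_(s <- l) pair_balanced s.2 =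
  \sum_(s <- l) minn (size s.2.1) (size s.2.2) + minn (size ab.1) (size ab.2).
Proof.
elim: l => [|[p cd] l IHl] /=; first by rewrite !big_nil pair_word_downs !addn0.
rewrite downs_cat size_cat /= !big_cons /=.
have := size_downs_flip 0 (pair_word cd).
rewrite -/(pair_balanced cd) pair_word_downs; lia.
Qed.

(** * Marked Dyson symbols as lists of segments *)

(** The pair of index [i] goes with the mark [p_i] for [1 <= i <= k]; the mark
    [p_0 = 1] is left out, and the pair of index [k + 1] is the last pair. *)
Definition symbol_segments k (eta : symbol k.+1) : seq segment :=
  zip (behead eta.2) (take k eta.1).

Definition symbol_last k (eta : symbol k.+1) : partn * partn :=
  nth (empty_partn, empty_partn) eta.1 k.

Section SymbolSegments.
Variables (k : nat) (eta : symbol k.+1).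
Hypothesis eta0 : mark eta 0 = 1.
Let l := symbol_segments eta.
Let s0 : segment := (1, (empty_partn, empty_partn)).

Lemma symbol_segments_zip :
  size (behead eta.2) = size (take k eta.1).
Proof. by rewrite size_behead size_take !size_tuple ltnSn. Qed.

Lemma size_symbol_segments : size l = k.
Proof.
by rewrite size1_zip !size_behead ?size_take !size_tuple /= ?ltnSn.
Qed.

Lemma map_fst_symbol_segments : 1 :: map fst l = eta.2.
Proof.
rewrite /l -/unzip1 unzip1_zip ?symbol_segments_zip //.
by case: eta eta0 => a [[|p0 p] //= sp]; rewrite /mark /= => ->.
Qed.

Lemma map_snd_symbol_segments : rcons (map snd l) (symbol_last eta) = eta.1.
Proof.
rewrite /l -/unzip2 unzip2_zip ?symbol_segments_zip //.
by rewrite /symbol_last -take_nth ?size_tuple // take_oversize ?size_tuple.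
Qed.

Lemma mark_segments i : mark eta i = nth 0 (1 :: map fst l) i.
Proof. by rewrite map_fst_symbol_segments. Qed.

Lemma alpha_segments i : i < k -> alpha eta i.+1 = (nth s0 l i).2.1.
Proof.
move=> lt_ik; rewrite /alpha -map_snd_symbol_segments nth_rcons size_map.
by rewrite size_symbol_segments lt_ik (nth_map s0) // size_symbol_segments.
Qed.

Lemma beta_segments i : i < k -> beta eta i.+1 = (nth s0 l i).2.2.
Proof.
move=> lt_ik; rewrite /beta -map_snd_symbol_segments nth_rcons size_map.
by rewrite size_symbol_segments lt_ik (nth_map s0) // size_symbol_segments.
Qed.

Lemma alpha_last : alpha eta k.+1 = (symbol_last eta).1.
Proof. by []. Qed.

Lemma beta_last : beta eta k.+1 = (symbol_last eta).2.
Proof. by []. Qed.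

Lemma last_mark : mark eta k = last 1 (map fst l).
Proof.
by rewrite mark_segments -[in LHS]size_symbol_segments -(size_map fst) nth_last.
Qed.

Lemma is_symbol_segments :
  is_symbol 1 l (symbol_last eta) <->
  [/\ forall i, 1 <= i <= k.+1 - 1 -> mark eta i.-1 <= mark eta i,
      forall i, 1 <= i <= k.+1 - 1 -> forall x,
        (x \in parts (alpha eta i)) || (x \in parts (beta eta i)) ->
        mark eta i.-1 <= x <= mark eta i &
      forall x, (x \in parts (alpha eta k.+1)) || (x \in parts (beta eta k.+1)) ->
        mark eta (k.+1 - 1) <= x].
Proof.
have sl := size_symbol_segments.
rewrite !subn1 /= /is_symbol.
have stepE i : i < k -> segment_le (nth s0 (s0 :: l) i) (nth s0 l i) =
    (mark eta i <= mark eta i.+1) &&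
    all (fun x => mark eta i <= x <= mark eta i.+1)
        (alpha eta i.+1 ++ beta eta i.+1).
  move=> lt_ik; rewrite alpha_segments // beta_segments //.
  rewrite !mark_segments (_ : 1 :: map fst l = map fst (s0 :: l)) //.
  by rewrite !(nth_map s0) //= sl // ltnS ltnW.
split=> [/andP[/(pathP s0) lP abP]|[mono btw lst]].
  have {}lP i : i < k ->
      (mark eta i <= mark eta i.+1) &&
      all (fun x => mark eta i <= x <= mark eta i.+1)
          (alpha eta i.+1 ++ beta eta i.+1).
    by move=> lt_ik; rewrite -stepE // lP // sl.
  split=> [[|i] //= lt_ik|[|i] //= lt_ik x|x].
  - by have /andP[] := lP i lt_ik.
  - by rewrite -mem_cat; have /andP[_ /allP] := lP i lt_ik; apply.
  - by rewrite -mem_cat last_mark; apply: (allP abP).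
apply/andP; split.
  apply/(pathP s0) => i; rewrite sl => lt_ik; rewrite stepE //.
  apply/andP; split; first exact: (mono i.+1).
  by apply/allP => x; rewrite mem_cat => xi; apply: (btw i.+1).
by rewrite -last_mark; apply/allP => x; rewrite mem_cat; apply: lst.
Qed.

Lemma sum_pairs (F : partn * partn -> nat) :
  \sum_(1 <= i < k.+2) F (alpha eta i, beta eta i) =
  \sum_(s <- l) F s.2 + F (symbol_last eta).
Proof.
rewrite big_add1 /= big_nat_recr //=; congr addn; last first.
  by rewrite alpha_last beta_last -surjective_pairing.
rewrite (big_nth s0) size_symbol_segments.
apply: eq_big_nat => i /= lt_ik.
by rewrite alpha_segments // beta_segments // -surjective_pairing.
Qed.

Lemma sum_marks : \sum_(1 <= i < k.+1) mark eta i = \sum_(s <- l) s.1.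
Proof.
rewrite big_add1 /= (big_nth s0) size_symbol_segments.
apply: eq_big_nat => i /= lt_ik.
by rewrite mark_segments /= (nth_map s0) // size_symbol_segments.
Qed.

Lemma pair_balancedE (ab : partn * partn) : pair_balanced ab =
  if size ab.2 <= size ab.1 then balanced ab.1 ab.2 else balanced ab.2 ab.1.
Proof.
rewrite /pair_balanced /pair_word; case: ifP => _;
  by rewrite balanced_word //; exact: partn_sorted.
Qed.

Lemma total_balanced_segments :
  total_balanced eta = \sum_(s <- l) pair_balanced s.2.
Proof.
rewrite /total_balanced big_nat_recr //= {2}/symbol_balanced eqxx addn0.
have -> : \sum_(1 <= i < k.+1) symbol_balanced eta i =
          \sum_(1 <= i < k.+1) pair_balanced (alpha eta i, beta eta i).
  apply: eq_big_nat => i /andP[_ lt_ik].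
  by rewrite /symbol_balanced pair_balancedE /= ltn_eqF.
apply/eqP; rewrite -(eqn_add2r (pair_balanced (symbol_last eta))) -sum_pairs.
by rewrite [X in _ == X]big_nat_recr //= alpha_last beta_last -surjective_pairing.
Qed.

(** The weight only depends on the word of the symbol. *)
Lemma weight_word :
  weight eta = word_weight (symbol_word l (symbol_last eta)).
Proof.
rewrite /weight /word_weight sum_marks sumn_symbol_word.
rewrite (sum_pairs (fun ab => sumn ab.1 + sumn ab.2)); congr (_ + _).
rewrite size_ups_symbol_word size_symbol_segments total_balanced_segments.
congr (_ * _).
  rewrite /large_length (sum_pairs (fun ab => maxn (size ab.1) (size ab.2))); lia.
rewrite /small_length (sum_pairs (fun ab => minn (size ab.1) (size ab.2))).
by rewrite -size_downs_symbol_word addnK.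
Qed.

End SymbolSegments.

Lemma symbol_segments_inj k (eta eta' : symbol k.+1) :
  mark eta 0 = 1 -> mark eta' 0 = 1 ->
  symbol_segments eta = symbol_segments eta' ->
  symbol_last eta = symbol_last eta' -> eta = eta'.
Proof.
move=> e0 e0' El Ea.
have E1 : eta.1 = eta'.1.
  by apply: val_inj => /=; rewrite -!map_snd_symbol_segments // El Ea.
have E2 : eta.2 = eta'.2.
  by apply: val_inj => /=; rewrite -!map_fst_symbol_segments // El.
by rewrite [eta]surjective_pairing E1 E2 -surjective_pairing.
Qed.

Lemma symbol_segments_surj k (l : seq segment) ab : size l = k ->
  exists eta : symbol k.+1,
    [/\ mark eta 0 = 1, symbol_segments eta = l & symbol_last eta = ab].
Proof.
move=> sl.
have s1 : size (rcons (map snd l) ab) == k.+1 by rewrite size_rcons size_map sl.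
have s2 : size (1 :: map fst l) == k.+1 by rewrite /= size_map sl.
exists (Tuple s1, Tuple s2); split=> //.
  rewrite /symbol_segments /= -cats1 -sl -(size_map snd) take_size_cat //.
  exact: zip_unzip.
by rewrite /symbol_last /= nth_rcons size_map sl ltnn eqxx.
Qed.

(** * The condition on the last pair *)

(* The mark of the default segment is [p_0]. *)
Definition segment0 : segment := (1, (empty_partn, empty_partn)).

(** The condition on the largest parts of the last pair [ab], for a list with
    at least one segment: the largest part of the first nonempty partition of
    [ab], or the last mark if both are empty, takes the least value which the
    other parts and marks allow. *)
Definition is_tight (l : seq segment) (ab : partn * partn) : bool :=
  let: (p, cd) := last segment0 l in
  let q := nth 0 (1 :: map fst l) (size l).-1 in
  match parts ab.1, parts ab.2 with
  | x :: a, _ => x == head p a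
  | [::], x :: b => x == head p b
  | [::], [::] => p == maxn (head q cd.1) (head q cd.2)
  end.

Lemma marked_Dyson_segments k (eta : symbol k.+2) :
  marked_Dyson eta <->
  [/\ mark eta 0 = 1, is_symbol 1 (symbol_segments eta) (symbol_last eta) &
      is_tight (symbol_segments eta) (symbol_last eta)].
Proof.
have tightE : mark eta 0 = 1 ->
    is_tight (symbol_segments eta) (symbol_last eta) =
    match parts (alpha eta k.+2), parts (beta eta k.+2) with
    | x :: a, _ => x == head (mark eta k.+1) a
    | [::], x :: b => x == head (mark eta k.+1) b
    | [::], [::] => mark eta k.+1 ==
        maxn (head (mark eta k) (alpha eta k.+1)) (head (mark eta k) (beta eta k.+1))
    end.
  move=> eta0; have sl := size_symbol_segments eta.
  rewrite /is_tight (surjective_pairing (last _ _)) sl /= -mark_segments //.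
  have -> : (last segment0 (symbol_segments eta)).1 = mark eta k.+1.
    by rewrite last_mark // (last_map fst _ segment0).
  rewrite (alpha_segments eta (ltnSn k)) (beta_segments eta (ltnSn k)).
  by rewrite -nth_last sl /= alpha_last beta_last.
split=> [[m0 mono btw lst a1 a2 b1 b2 ab0]|[m0 /is_symbol_segments[] // mono btw lst]].
  split=> //; first exact/is_symbol_segments.
  rewrite tightE //; move: a1 a2 b1 b2 ab0; rewrite !subSS !subn0.
  case: (parts (alpha eta k.+2)) => [|x [|y a]] /=; last 2 first.
  - by move=> /(_ erefl)->.
  - by move=> _ /(_ isT)->.
  case: (parts (beta eta k.+2)) => [|x [|y b]] /= _ _.
  - by move=> _ _ /(_ erefl erefl)->.
  - by move=> /(_ erefl erefl)->.
  - by move=> _ /(_ erefl isT)->.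
rewrite tightE // => tgt; split=> //; rewrite ?subSS ?subn0; move: tgt;
  case: (parts (alpha eta k.+2)) => [|x [|y a]] //=;
  try (by move=> /eqP->);
  case: (parts (beta eta k.+2)) => [|x' [|y' b]] //=;
  by move=> /eqP->.
Qed.

Definition raise_head (s : seq nat) : seq nat :=
  if s is x :: s' then x.+1 :: s' else [::].

Lemma raise_head_partn s : is_partn s -> is_partn (raise_head s).
Proof.
case: s => //= x s /andP[]; rewrite /is_partn /= !inE negb_or => xs /andP[_ ->].
by rewrite andbT; case: s xs => //= y s /andP[le ->]; rewrite andbT leqW.
Qed.

Definition raise_partn (la : partn) : partn :=
  Partn (raise_head_partn (partsP la)).

Definition raise_last (l : seq segment) : seq segment :=
  rcons (take (size l).-1 l) ((last segment0 l).1.+1, (last segment0 l).2).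

(** Increases by one the part or the mark that tightness forces to its least
    value. *)
Definition raise (eta : seq segment * (partn * partn)) :
    seq segment * (partn * partn) :=
  let: (l, ab) := eta in
  match parts ab.1, parts ab.2 with
  | _ :: _, _ => (l, (raise_partn ab.1, ab.2))
  | [::], _ :: _ => (l, (ab.1, raise_partn ab.2))
  | [::], [::] => (raise_last l, ab)
  end.

Lemma raise_last_rcons l s : raise_last (rcons l s) = rcons l (s.1.+1, s.2).
Proof.
rewrite /raise_last last_rcons size_rcons /=; congr rcons.
by rewrite -cats1 take_size_cat.
Qed.

Lemma is_symbol_rcons c l s ab :
  is_symbol c (rcons l s) ab =
  [&& path segment_le (c, (empty_partn, empty_partn)) l,
      segment_le (last (c, (empty_partn, empty_partn)) l) s &
      all (leq s.1) (pair_parts ab)].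
Proof. by rewrite /is_symbol rcons_path map_rcons last_rcons andbA. Qed.

Lemma is_tight_rcons l s ab :
  is_tight (rcons l s) ab =
  match parts ab.1, parts ab.2 with
  | x :: a, _ => x == head s.1 a
  | [::], x :: b => x == head s.1 b
  | [::], [::] => s.1 == maxn (head (last segment0 l).1 s.2.1)
                              (head (last segment0 l).1 s.2.2)
  end.
Proof.
rewrite /is_tight last_rcons; case: s => p cd /=.
suff -> : nth 0 (1 :: map fst (rcons l (p, cd))) (size (rcons l (p, cd))).-1 =
          (last segment0 l).1 by [].
rewrite size_rcons map_rcons -rcons_cons nth_rcons /= size_map ltnSn.
by rewrite -(size_map fst) nth_last -(last_map fst l segment0).
Qed.

Lemma size_downs_symbol_wordE l ab :
  size (downs (symbol_word l ab)) =
  \sum_(s <- l) minn (size s.2.1) (size s.2.2) + minn (size ab.1) (size ab.2) -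
  \sum_(s <- l) pair_balanced s.2.
Proof. by rewrite -size_downs_symbol_word addnK. Qed.

Lemma word_weight_raise l s ab :
  word_weight (symbol_word (raise (rcons l s, ab)).1 (raise (rcons l s, ab)).2) =
  (word_weight (symbol_word (rcons l s) ab)).+1.
Proof.
rewrite /word_weight !sumn_symbol_word !size_ups_symbol_word.
rewrite !size_downs_symbol_wordE /raise.
case: ab => -[[|x a] aP] [[|y b] bP] /=; last 3 first.
- by rewrite !addSn ?addnS.
- by rewrite !(addSn, addnS).
- by rewrite !(addSn, addnS).
by rewrite raise_last_rcons -!cats1 !big_cat !big_seq1 !size_cat /=
  !(addSn, addnS).
Qed.

(** The inverse of raising, on a partition that is not tight. *)
Lemma lower_head p x a : is_partn (x :: a) -> all (leq p) (x :: a) ->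
  0 < p -> x != head p a ->
  [/\ is_partn (x.-1 :: a), all (leq p) (x.-1 :: a) & x.-1.+1 = x].
Proof.
rewrite /is_partn => /andP[sa]; rewrite inE negb_or => /andP[x0 a0].
rewrite [all _ _]/= => /andP[px pa] p0 xa.
have lt : head p a < x by case: a sa pa xa {a0} => [|y a] /=; lia.
have ge : p <= head p a by case: a pa {sa a0 lt xa} => [|y a] //= /andP[].
split; last by lia.
  apply/andP; split; last by rewrite inE negb_or a0 andbT; lia.
  case: a sa lt {a0 pa xa ge} => //= y a /andP[_ ->] lt; rewrite andbT; lia.
by rewrite [all _ _]/= pa andbT; lia.
Qed.

Lemma head_not_raised p x a : is_partn (x :: a) -> all (leq p) (x :: a) ->
  x.+1 != head p a.
Proof.
move=> /andP[+ _] /= /andP[px _]; case: a => [|y a] /=; first by lia.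
by move=> /andP[]; lia.
Qed.

(** Raised symbols are not tight; by [raise_inj] and [raise_surj], raising is a
    bijection onto the symbols that are not tight. *)
Lemma raise_not_tight eta :
  0 < size eta.1 -> is_symbol 1 eta.1 eta.2 ->
  [/\ size (raise eta).1 = size eta.1,
      is_symbol 1 (raise eta).1 (raise eta).2 &
      ~~ is_tight (raise eta).1 (raise eta).2].
Proof.
case: eta => l ab; case/lastP: l => [//|l s] _.
rewrite is_symbol_rcons /= => /and3P[lP sP abP].
have [ab0|ab0] := boolP (pair_parts ab == [::]).
  case: ab abP ab0 => -[[|x a] aP] [[|y b] bP] // abP _.
  rewrite /raise /= raise_last_rcons !size_rcons is_symbol_rcons lP.
  rewrite is_tight_rcons /=; split=> //.
    rewrite andbT /=; move: sP; rewrite /segment_le /= => /andP[le sP].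
    rewrite leqW //=.
    apply: sub_all sP => x /andP[-> /leqW->] //.
  have : all (leq^~ s.1) (head (last segment0 l).1 s.2.1 ::
                         [:: head (last segment0 l).1 s.2.2]).
    have /andP[le /allP sP'] := sP.
    have hd la : {subset parts la <= pair_parts s.2} ->
        head (last segment0 l).1 la <= s.1.
      case: (parts la) => [|x a] sub //=.
      by have /andP[] := sP' x (sub x (mem_head _ _)).
    by rewrite /= !hd // => x xs; rewrite mem_cat xs ?orbT.
  by move=> /= /and3P[]; lia.
have {ab0} : 0 < size (pair_parts ab) by case: pair_parts ab0.
case: ab abP => -[[|x a] aP] [[|y b] bP] // abP _;
  rewrite !size_rcons is_symbol_rcons is_tight_rcons lP sP /=.
- split=> //; last exact: head_not_raised.
  by move: abP => /= /andP[/leqW-> ->].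
- split=> //; last first.
    apply: head_not_raised => //.
    by move: abP; rewrite /pair_parts all_cat => /andP[].
  by move: abP => /= /andP[/leqW-> ->].
- split=> //; last first.
    apply: head_not_raised => //.
    by move: abP; rewrite /pair_parts all_cat => /andP[].
  by move: abP => /= /andP[/leqW-> ->].
Qed.

Lemma raise_inj eta eta' :
  0 < size eta.1 -> 0 < size eta'.1 -> raise eta = raise eta' -> eta = eta'.
Proof.
case: eta eta' => l ab [l' ab'] /=.
case/lastP: l => [//|l s] _; case/lastP: l' => [//|l' s'] _.
case: ab ab' => -[[|x a] aP] [[|y b] bP] [[[|x' a'] aP'] [[|y' b'] bP']] //=;
  rewrite ?raise_last_rcons.
- case=> /rcons_inj[-> E1 E2].
  rewrite (_ : s = s'); last by rewrite [s]surjective_pairing E1 E2 -surjective_pairing.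
  by congr (_, (_, _)); apply: val_inj.
all: move=> E; have -> : rcons l s = rcons l' s' by case: E.
all: have Ea := congr1 (fun x => parts x.2.1) E.
all: have Eb := congr1 (fun x => parts x.2.2) E.
all: congr pair; congr pair; apply: val_inj => //=; move: Ea Eb => /=; congruence.
Qed.

Lemma raise_surj eta :
  0 < size eta.1 -> is_symbol 1 eta.1 eta.2 -> ~~ is_tight eta.1 eta.2 ->
  exists eta', [/\ size eta'.1 = size eta.1, is_symbol 1 eta'.1 eta'.2 &
                   raise eta' = eta].
Proof.
case: eta => l ab; case/lastP: l => [//|l s] _.
rewrite is_symbol_rcons is_tight_rcons /= => /and3P[lP sP abP].
have s0 : 0 < s.1.
  have c1 : forall t m, path segment_le (m, t) l -> 1 <= m ->
      1 <= (last (m, t) l).1.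
    elim: (l) => [|[q cd] l' IHl] t m //= /andP[/andP[/= mq _] /IHl IH] m0.
    by apply: IH; apply: leq_trans mq.
  by apply: leq_trans (c1 _ _ lP isT) _; case/andP: sP.
case: ab abP => -[[|x a] aP] [[|y b] bP] abP tgt.
- case: s sP abP s0 tgt => p cd /andP[/= qp /allP sP] abP p0.
  rewrite -/segment0 in qp sP *; set q := (last segment0 l).1 in qp sP *.
  move=> tgt.
  have hd (la : partn) : {subset parts la <= pair_parts cd} ->
      [/\ q <= head q la, head q la <= p &
          {in parts la, forall x, q <= x <= head q la}].
    move=> sub; have := partn_sorted la; case: (parts la) sub => [|x c] //= sub xc.
    have /andP[-> ->] := sP x (sub x (mem_head _ _)); split=> // y yc.
    have /andP[-> _] := sP y (sub y yc); rewrite /=.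
    by move: yc; rewrite inE => /predU1P[->|/(allP (order_path_min geq_trans xc))].
  have [|q1 p1 c1] := hd cd.1; first by move=> x xc; rewrite mem_cat xc.
  have [|q2 p2 c2] := hd cd.2; first by move=> x xc; rewrite mem_cat xc orbT.
  exists (rcons l (p.-1, cd), (Partn aP, Partn bP)).
  rewrite /= raise_last_rcons /= !size_rcons is_symbol_rcons lP prednK //; split=> //.
  rewrite /segment_le /= -/segment0 -/q andbT; apply/andP; split.
    by move: tgt q1 p1 p2 p0; clear; lia.
  apply/allP => x; rewrite mem_cat => /orP[/c1|/c2];
    by move: tgt p1 p2; clear; lia.
- have [bP' pb yE] := lower_head bP abP s0 tgt.
  exists (rcons l s, (Partn aP, Partn bP')).
  rewrite is_symbol_rcons lP sP /=; split=> //; congr (_, (_, _)).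
  by apply: val_inj => /=; rewrite yE.
- have pa : all (leq s.1) (x :: a) by move: abP; rewrite /pair_parts all_cat => /andP[].
  have [aP' pa' xE] := lower_head aP pa s0 tgt.
  have pab : all (leq s.1) (pair_parts (Partn aP', Partn bP)).
    by rewrite /pair_parts all_cat pa'.
  exists (rcons l s, (Partn aP', Partn bP)).
  rewrite is_symbol_rcons lP sP pab; split=> //=.
  by congr (_, (_, _)); apply: val_inj => /=; rewrite xE.
- have /andP[pa pb] : all (leq s.1) (x :: a) && all (leq s.1) (y :: b).
    by rewrite -all_cat.
  have [aP' pa' xE] := lower_head aP pa s0 tgt.
  have pab : all (leq s.1) (pair_parts (Partn aP', Partn bP)).
    by rewrite /pair_parts all_cat pa'.
  exists (rcons l s, (Partn aP', Partn bP)).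
  rewrite is_symbol_rcons lP sP pab; split=> //=.
  by congr (_, (_, _)); apply: val_inj => /=; rewrite xE.
Qed.

(** The symbols with [k] segments, [p_0 = 1] and weight [n], first without and
    then with the condition on the last pair. *)
Definition symbol_of (k n : nat) (eta : seq segment * (partn * partn)) : Prop :=
  [/\ size eta.1 = k, is_symbol 1 eta.1 eta.2 &
      word_weight (symbol_word eta.1 eta.2) = n].

Definition tight_symbol_of (k n : nat) (eta : seq segment * (partn * partn)) :=
  symbol_of k n eta /\ is_tight eta.1 eta.2.

Lemma word_weight_raise_eta eta : 0 < size eta.1 ->
  word_weight (symbol_word (raise eta).1 (raise eta).2) =
  (word_weight (symbol_word eta.1 eta.2)).+1.
Proof.
by case: eta => l ab; case/lastP: l => // l s _; rewrite word_weight_raise.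
Qed.

(** Raising turns the symbols of weight [n] into those of weight [n.+1] that
    are not tight. *)
Lemma counted_tight k n r s :
  counted (symbol_of k.+1 n) r -> counted (tight_symbol_of k.+1 n.+1) s ->
  counted (symbol_of k.+1 n.+1) (s + r).
Proof.
move=> cr cs.
apply: (@counted_ext _ (fun eta => tight_symbol_of k.+1 n.+1 eta \/
    (symbol_of k.+1 n.+1 eta /\ ~~ is_tight eta.1 eta.2))) => [eta|].
  rewrite /tight_symbol_of; case: (is_tight eta.1 eta.2) => //=;
    by split=> [[[]|[]]|]//; auto.
apply: counted_or => [eta [_ ->] []//|//|].
apply: (counted_image (f := raise)) cr => [eta|eta eta'|eta].
- move=> [se symb we]; have se0 : 0 < size eta.1 by rewrite se.
  have [sr symbr tr] := raise_not_tight se0 symb.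
  by split=> //; split; rewrite // ?sr // word_weight_raise_eta // we.
- by move=> [se _ _] [se' _ _]; apply: raise_inj; rewrite ?se ?se'.
- move=> [[se symb we] tgt].
  have [|eta' [se' symb' etaE]] := raise_surj _ symb tgt; first by rewrite se.
  exists eta' => //; split; rewrite ?se' //.
  by apply: succn_inj; rewrite -word_weight_raise_eta ?se' ?se // etaE.
Qed.

Lemma counted_marked_Dyson k n r :
  counted (marked_Dyson_symbols k.+2 n) r ->
  counted (tight_symbol_of k.+1 n) r.
Proof.
apply: (counted_image (f := fun eta : symbol k.+2 =>
  (symbol_segments eta, symbol_last eta))).
- move=> eta [/marked_Dyson_segments[eta0 symb tgt] wt]; split=> //; split=> //=.
    exact: size_symbol_segments.
  by rewrite -weight_word.
- move=> eta eta' [/marked_Dyson_segments[eta0 _ _] _].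
  move=> [/marked_Dyson_segments[eta0' _ _] _] [].
  exact: symbol_segments_inj.
- move=> [l ab] [[/= sl symb wt] tgt].
  have [eta [eta0 El Eab]] := symbol_segments_surj ab sl.
  exists eta; last by rewrite El Eab.
  split; first by apply/marked_Dyson_segments; rewrite El Eab.
  by rewrite weight_word // El Eab.
Qed.

(** * Conjugate partitions *)

(** The conjugate partition: a new largest part [x] adds one to the first [x]
    columns. *)
Fixpoint conjugate (s : seq nat) : seq nat :=
  if s is x :: s' then
    map succn (conjugate s') ++ nseq (x - size (conjugate s')) 1
  else [::].

Lemma is_partn_cons x s :
  is_partn (x :: s) = [&& 0 < x, head 0 s <= x & is_partn s].
Proof.
rewrite /is_partn inE negb_or /= eq_sym -lt0n.
by case: s => [|y s] /=; rewrite ?andbT // -!andbA; do !bool_congr.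
Qed.

Lemma size_conjugate s : is_partn s -> size (conjugate s) = head 0 s.
Proof.
elim: s => //= x s IHs; rewrite is_partn_cons => /and3P[_ le /IHs sz].
by rewrite size_cat size_map size_nseq sz subnKC.
Qed.

Lemma sumn_conjugate s : is_partn s -> sumn (conjugate s) = sumn s.
Proof.
elim: s => //= x s IHs; rewrite is_partn_cons => /and3P[_ le sP].
have sumS (t : seq nat) : sumn (map succn t) = size t + sumn t.
  by elim: t => //= y t ->; lia.
rewrite sumn_cat sumS sumn_nseq mul1n IHs // size_conjugate //; lia.
Qed.

Lemma conjugate_partn s : is_partn s -> is_partn (conjugate s).
Proof.
elim: s => //= x s IHs; rewrite is_partn_cons => /and3P[_ _ /IHs].
move: (conjugate s) => t {IHs}; move: (x - _) => m.
elim: t => [_|y t IHt] /=.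
  by elim: m => //= m; rewrite is_partn_cons => ->; case: m.
rewrite !is_partn_cons => /and3P[y0 le /IHt->]; rewrite andbT /=.
by case: t le {IHt} => //=; case: m.
Qed.

(** Adding one to every part and then [m] new parts equal to one adds a first
    column, of height [size u + m]. *)
Lemma conjugate_columns u m : 0 < size u + m ->
  conjugate (map succn u ++ nseq m 1) = size u + m :: conjugate u.
Proof.
elim: u => [|y u IHu] /=.
  case: m => // m _; elim: m => //= m IHm.
  by rewrite -/(nseq m.+1 1) /= in IHm *; rewrite IHm.
move=> _; have [/eqP|] := posnP (size u + m).
  by rewrite addn_eq0 size_eq0 => /andP[/eqP-> /eqP->]; rewrite /= !subn0.
by move=> /IHu->; rewrite /= subSS.
Qed.

Lemma conjugateK s : is_partn s -> conjugate (conjugate s) = s.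
Proof.
elim: s => //= x s IHs; rewrite is_partn_cons => /and3P[x0 le sP].
have sx : size (conjugate s) + (x - size (conjugate s)) = x.
  by rewrite size_conjugate ?subnKC.
by rewrite conjugate_columns ?sx // IHs.
Qed.

Lemma head_conjugate s : is_partn s -> head 0 (conjugate s) = size s.
Proof.
by move=> sP; rewrite -size_conjugate ?conjugate_partn // conjugateK.
Qed.

(** * The crank *)

(** Pairs with weight [n] and [d] more parts in the second component. *)
Definition pair_of (n : nat) (d : int) (ab : partn * partn) : Prop :=
  sumn ab.1 + sumn ab.2 + size ab.1 * size ab.2 = n /\
  (Posz (size ab.2) - Posz (size ab.1) = d)%R.

(** The formula that gives the crank, with [w] in place of the number of ones. *)
Definition crank_at (w : nat) (la : seq nat) : int :=
  if w == 0 then Posz (head 0 la) else (Posz (count (ltn w) la) - Posz w)%R.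

Definition crank_pair_of (n : nat) (d : int) (x : partn * nat) : Prop :=
  [/\ sumn x.1 = n, x.2 <= ones x.1 & crank_at x.2 x.1 = d].

Lemma crankE la : crank la = crank_at (ones la) la.
Proof. by []. Qed.

Lemma is_partn_rcons1 s : is_partn (rcons s 1) = is_partn s.
Proof.
elim: s => //= x s IHs; rewrite !is_partn_cons IHs.
by case: x => // x; case: s {IHs}.
Qed.

Lemma ones_rcons1 s : ones (rcons s 1) = (ones s).+1.
Proof. by rewrite /ones -cats1 count_cat addn1. Qed.

Lemma partn_rcons1 s : is_partn s -> 0 < ones s -> exists t, s = rcons t 1.
Proof.
case/lastP: s => // t x /andP[st s0]; rewrite /ones -has_count has_pred1.
move=> s1; exists t; congr rcons.
move: s0; rewrite mem_rcons inE negb_or eq_sym => /andP[x0 _].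
move: st; rewrite (sorted_pairwise geq_trans) -cats1 pairwise_cat.
move=> /and3P[/allrelP tx _ _]; rewrite mem_rcons inE in s1.
case/predU1P: s1 => [//|t1]; have := tx 1 x t1 (mem_head _ _).
by move: x0 => /=; clear; lia.
Qed.

Definition add_one (la : partn) : partn := insubd empty_partn (rcons la 1).

Lemma add_oneE la : parts (add_one la) = rcons la 1.
Proof.
have -> : parts (add_one la) = val (add_one la) by [].
by rewrite insubdK //; have := partsP la; rewrite -/(is_partn _) -is_partn_rcons1.
Qed.

(** Among the pairs made of a partition and some number [w] of its ones, those
    with [w] maximal are counted by the crank; in the others, one of the ones
    can be removed. *)
Lemma counted_crank n d r s : 0 < n ->
  counted (crank_pair_of n d) r ->
  counted (fun la : partn => sumn la = n.+1 /\ crank la = d) s ->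
  counted (crank_pair_of n.+1 d) (s + r).
Proof.
move=> n0 cr cs.
apply: (@counted_ext _ (fun x => (crank_pair_of n.+1 d x /\ x.2 = ones x.1) \/
    (crank_pair_of n.+1 d x /\ x.2 < ones x.1))) => [x|].
  split=> [[[]|[]] //|xP]; have [_ le _] := xP.
  have [lt|ge] := ltnP x.2 (ones x.1); [by right|left; split=> //].
  by apply/eqP; rewrite eqn_leq le ge.
apply: counted_or => [x [_ ->]||]; first by rewrite ltnn => -[].
  apply: (counted_image (f := fun la : partn => (la, ones la))) cs.
  - by move=> la [sla cla]; split=> //; split.
  - by move=> la la' _ _ [].
  - by move=> [la w] [[/= sla _ cla] ww]; exists la; rewrite ?ww // crankE -ww.
apply: (counted_image (f := fun x : partn * nat => (add_one x.1, x.2))) cr.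
- move=> [la w] [/= sla wla cla]; split; rewrite /= ?add_oneE ?ones_rcons1 //.
  split; rewrite /= ?add_oneE ?ones_rcons1 //.
  + by rewrite -cats1 sumn_cat sla /= addn1.
  + exact: leqW.
  rewrite -cla /crank_at -cats1 count_cat.
  case: eqP => [_|/eqP w0]; last by rewrite /= ltnS leqn0 (negPf w0) !addn0.
  by case: (parts la) sla => //= sla; rewrite -sla in n0.
- move=> [la w] [la' w'] _ _ [/(congr1 parts)]; rewrite !add_oneE.
  by move=> /rcons_inj[/val_inj-> ->].
move=> [la w] [[/= sla _ cla] wla].
have [t lat] := partn_rcons1 (partsP la) (leq_ltn_trans (leq0n w) wla).
have tP : is_partn t by rewrite -is_partn_rcons1 -lat; exact: partsP.
exists (Partn tP, w); last first.
  by congr (_, _); apply: val_inj; rewrite /= add_oneE lat.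
move: sla wla cla; rewrite lat ones_rcons1 -cats1 sumn_cat /= addn1 => -[st] wt ct.
split=> //=; rewrite -ct /crank_at count_cat.
case: eqP => [_|/eqP w0]; last by rewrite /= ltnS leqn0 (negPf w0) !addn0.
by case: t {lat tP wt ct} st => //= st; rewrite -st in n0.
Qed.

Lemma partn_ones s w : is_partn s -> w <= ones s ->
  exists2 t, is_partn t & s = t ++ nseq w 1.
Proof.
elim: w s => [|w IHw] s sP; first by exists s; rewrite ?cats0.
move=> lt; have [t st] := partn_rcons1 sP (leq_trans (ltn0Sn w) lt).
move: sP lt; rewrite st is_partn_rcons1 ones_rcons1 ltnS => tP /(IHw _ tP)[u uP ->].
by exists u; rewrite // rcons_cat -cats1 -[[:: 1]]/(nseq 1 1) -nseqD addn1.
Qed.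

Lemma partn_split w s : is_partn s ->
  s = [seq x <- s | w < x] ++ [seq x <- s | x <= w].
Proof.
move=> /andP[ss _]; elim: s ss => //= x s IHs xs.
have xmin := order_path_min geq_trans xs.
case: leqP => [le|_] /=; last by rewrite -IHs ?(path_sorted xs).
have sw : all (fun y => y <= w) s.
  by apply: sub_all xmin => y /= yx; apply: leq_trans yx le.
have /all_filterP-> := sw.
rewrite (_ : [seq y <- s | w < y] = [::]) //.
apply/eqP; rewrite -[_ == _]negbK -has_filter; apply/hasPn => y /(allP sw).
by rewrite -leqNgt.
Qed.

Lemma is_partn_cat s t : is_partn (s ++ t) =
  [&& is_partn s, is_partn t & allrel geq s t].
Proof.
rewrite /is_partn !(sorted_pairwise geq_trans) pairwise_cat mem_cat negb_or.
by case: allrel; rewrite ?andbF // andbT /= -!andbA; do !bool_congr.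
Qed.

Lemma is_partn_nseq1 w : is_partn (nseq w 1).
Proof. by elim: w => //= w IHw; rewrite is_partn_cons IHw; case: w {IHw}. Qed.

Lemma is_partn_map_addn w s : is_partn s -> is_partn (map (addn w) s).
Proof.
elim: s => //= x s IHs; rewrite !is_partn_cons => /and3P[x0 le /IHs->].
by rewrite addn_gt0 x0 orbT; case: s le {IHs} => //= y s; rewrite leq_add2l => ->.
Qed.

Lemma partn_gt0 s : is_partn s -> all (ltn 0) s.
Proof.
by move=> /andP[_ s0]; apply/allP => x xs /=; rewrite lt0n; apply: contraNneq s0 => <-.
Qed.

Lemma partn_head s : is_partn s -> all (geq (head 0 s)) s.
Proof.
case: s => //= x s /andP[xs _]; rewrite leqnn /=.
exact: (order_path_min geq_trans xs).
Qed.

(** The partition formed from a pair [(a, b)] with [a] of [w] parts, [w > 0]: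
    the parts of [b] increased by [w], then the conjugate of [a] with its
    largest part [w] replaced by [w] ones. For empty [a] it is the conjugate of
    [b], whose largest part is the length of [b]. *)
Definition merge_pair (a b : seq nat) : seq nat :=
  if a is [::] then conjugate b
  else map (addn (size a)) b ++ behead (conjugate a) ++ nseq (size a) 1.

Lemma merge_pair_parts a b : is_partn a -> is_partn b -> 0 < size a ->
  exists2 g, is_partn (size a :: g) &
    [/\ conjugate a = size a :: g,
        merge_pair a b = map (addn (size a)) b ++ g ++ nseq (size a) 1,
        is_partn (merge_pair a b),
        [seq x <- merge_pair a b | size a < x] = map (addn (size a)) b &
        [seq x <- merge_pair a b | x <= size a] = g ++ nseq (size a) 1].
Proof.
move=> aP bP a0; have ha := head_conjugate aP.
have sa := size_conjugate aP; have caP := conjugate_partn aP.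
have [g cE] : exists g, conjugate a = size a :: g.
  case: (conjugate a) ha => [|y g] /= yE; first by rewrite -yE in a0.
  by exists g; rewrite yE.
have mE : merge_pair a b = map (addn (size a)) b ++ g ++ nseq (size a) 1.
  by rewrite /merge_pair cE; case: (a) a0.
move: (caP); rewrite cE => gP; exists g => //.
have gw : all (fun x => x <= size a) g.
  by have /andP[] := partn_head gP.
have bw : all (fun x => size a < x) (map (addn (size a)) b).
  rewrite all_map; apply: sub_all (partn_gt0 bP) => x /= x0.
  by rewrite -[X in X < _]addn0 ltn_add2l.
have rw : all (fun x => x <= size a) (g ++ nseq (size a) 1).
  by rewrite all_cat gw all_nseq a0 orbT.
have g1P : is_partn g by move: gP; rewrite is_partn_cons => /and3P[].
have mP : is_partn (merge_pair a b).
  rewrite mE !is_partn_cat is_partn_map_addn // g1P is_partn_nseq1 /=.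
  apply/andP; split.
    apply/allrelP => x y xg; rewrite mem_nseq => /andP[_ /eqP->] /=.
    exact: (allP (partn_gt0 g1P)).
  by apply/allrelP => x y /(allP bw) /ltnW xw /(allP rw) yw; exact: leq_trans yw xw.
split=> //; rewrite mE filter_cat.
  have /all_filterP-> := bw; rewrite -[RHS]cats0; congr cat.
  apply/eqP; rewrite -[_ == _]negbK -has_filter; apply/hasPn => y /(allP rw).
  by rewrite -leqNgt.
have /all_filterP-> := rw; rewrite -[RHS]cat0s; congr cat.
apply/eqP; rewrite -[_ == _]negbK -has_filter; apply/hasPn => y /(allP bw).
by rewrite -ltnNge.
Qed.

Lemma merge_pair_partn a b : is_partn a -> is_partn b -> is_partn (merge_pair a b).
Proof.
move=> aP bP; case: (posnP (size a)) => [/size0nil->|a0].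
  exact: conjugate_partn.
by have [g _ []] := merge_pair_parts aP bP a0.
Qed.

Definition merge_partn (ab : partn * partn) : partn :=
  Partn (merge_pair_partn (partsP ab.1) (partsP ab.2)).

(** The pair is recovered from the merged partition and [w = size a]: the
    parts above [w] come from [b], so that their number less [w] is the
    difference of the two lengths. *)
Lemma counted_crank_pair n d r :
  counted (pair_of n d) r -> counted (crank_pair_of n d) r.
Proof.
apply: (counted_image (f := fun ab : partn * partn => (merge_partn ab, size ab.1))).
- move=> [a b] [/= wt dE]; have aP := partsP a; have bP := partsP b.
  rewrite /crank_pair_of /=; have [a0|a0] := posnP (size a).
    move: wt dE; rewrite (size0nil a0) /= mul0n addn0 => wt dE.
    split=> //; first by rewrite sumn_conjugate.
    by rewrite /crank_at /= head_conjugate // -dE GRing.subr0.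
  have [g gP [cE mE _ mb _]] := merge_pair_parts aP bP a0.
  split.
  + have := sumn_conjugate aP; rewrite cE mE /= -wt !sumn_cat sumn_nseq mul1n => <-.
    have -> : sumn (map (addn (size a)) b) = size b * size a + sumn b.
      by elim: (parts b) => //= x s ->; rewrite mulSn; lia.
    by rewrite (mulnC (size b)); lia.
  + by rewrite mE /ones !count_cat count_nseq /= mul1n addnA leq_addl.
  + by rewrite /crank_at gtn_eqF // -dE -size_filter mb size_map.
- move=> [a b] [a' b'] _ _ [/= mEE sz].
  have aP := partsP a; have bP := partsP b.
  have a'P := partsP a'; have b'P := partsP b'.
  suff [Ea Eb] : parts a = parts a' /\ parts b = parts b'.
    by congr (_, _); apply: val_inj.
  have [a0|a0] := posnP (size a).
    have a'0 : size a' = 0 by rewrite -sz.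
    move: mEE; rewrite (size0nil a0) (size0nil a'0) /= => mEE; split=> //.
    by rewrite -(conjugateK bP) mEE conjugateK.
  have a'0 : 0 < size a' by rewrite -sz.
  have [g gP [cE _ _ mb ma]] := merge_pair_parts aP bP a0.
  have [g' gP' [cE' _ _ mb' ma']] := merge_pair_parts a'P b'P a'0.
  rewrite -mEE -sz in cE' mb' ma'.
  rewrite mb in mb'; rewrite ma in ma'.
  have Eg : g = g'.
    have szg : size g = size g'.
      by have := congr1 size ma'; rewrite !size_cat => /addIn.
    by move/eqP: ma'; rewrite eqseq_cat // => /andP[/eqP].
  split; last exact: (inj_map (@addnI _) mb').
  by rewrite -(conjugateK aP) cE Eg -cE' conjugateK.
- move=> [la w] [/= sla wla cla]; have laP := partsP la.
  have [w0|w0] := posnP w.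
    have bP := conjugate_partn laP.
    exists (empty_partn, Partn bP); last first.
      by congr (_, _); [apply: val_inj; rewrite /= conjugateK|rewrite w0].
    move: cla; rewrite w0 /crank_at /= => <-; split.
      by rewrite /= sumn_conjugate // mul0n addn0.
    by rewrite /= size_conjugate // GRing.subr0.
  have [t tP laE] := partn_ones laP wla.
  have tE := partn_split w tP.
  set B := [seq x <- t | w < x] in tE; set g := [seq x <- t | x <= w] in tE.
  move: (tP); rewrite tE is_partn_cat => /and3P[BP gP _].
  have wgP : is_partn (w :: g).
    rewrite is_partn_cons w0 gP andbT.
    have : all (fun x => x <= w) g by apply/allP => x; rewrite mem_filter => /andP[].
    by case: (g) => //= x g' /andP[].
  have aP := conjugate_partn wgP.
  have sa : size (conjugate (w :: g)) = w by rewrite size_conjugate.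
  pose b := map (subn^~ w) B.
  have Bb : map (addn w) b = B.
    rewrite -map_comp -[RHS]map_id; apply/eq_in_map => x.
    by rewrite mem_filter => /andP[/ltnW le _] /=; rewrite subnKC.
  have bP : is_partn b.
    rewrite /is_partn; apply/andP; split.
      rewrite sorted_map; case/andP: BP => sB _; apply: sub_sorted sB => x y /=.
      exact: leq_sub2r.
    apply/negP => /mapP[x]; rewrite mem_filter => /andP[wx _] /eqP.
    by rewrite eq_sym subn_eq0 leqNgt wx.
  have mE : merge_pair (conjugate (w :: g)) b = la.
    rewrite laE tE -catA -{1}Bb /merge_pair.
    have := sa; case E : (conjugate (w :: g)) => [|y s] => [/= wE|<-].
      by rewrite -wE in w0.
    by rewrite -E conjugateK // sa.
  move: (sumn_conjugate wgP) aP sa mE.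
  move: (conjugate (w :: g)) => A sumA aP sa mE.
  exists (Partn aP, Partn bP); last first.
    by congr (_, _) => //; apply: val_inj; rewrite /= -mE.
  split=> /=.
    rewrite sumA sa -sla laE tE !sumn_cat /= sumn_nseq mul1n -Bb.
    have -> : sumn (map (addn w) b) = size b * w + sumn b.
      by elim: (b) => //= x s ->; rewrite mulSn; lia.
    by rewrite (mulnC w); lia.
  rewrite sa -cla /crank_at gtn_eqF // laE count_cat -size_filter -/B.
  by rewrite count_nseq /= ltnNge w0 /= mul0n addn0 -Bb size_map.
Qed.

Lemma counted_pair_sym n d r : counted (pair_of n d) r -> counted (pair_of n (- d)%R) r.
Proof.
apply: (counted_image (f := fun ab : partn * partn => (ab.2, ab.1))).
- by move=> [a b] [/= <- <-]; split=> /=; rewrite ?GRing.opprB // mulnC [X in X + _]addnC.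
- by move=> [a b] [a' b'] _ _ [-> ->].
- move=> [a b] [/= wt dE]; exists (b, a) => //; split=> /=.
    by rewrite mulnC [X in X + _]addnC.
  by rewrite -[RHS]GRing.opprK -dE GRing.opprB.
Qed.

Lemma counted_pair_word_of n e r : counted (pair_of n (Posz e)) r ->
  counted (fun z => [/\ is_word z, word_weight z = n &
                        size (ups z) = size (downs z) + e]) r.
Proof.
apply: (counted_image (f := fun ab : partn * partn => word ab.2 ab.1)).
- move=> [a b] [/= wt dE]; rewrite /word_weight.
  rewrite word_ups ?word_downs; try exact: partn_sorted.
  rewrite (sumn_perm (perm_word _ _)) sumn_cat.
  split; [exact: word_is_word (partsP _) (partsP _)| |lia].
  by rewrite -wt mulnC [X in X + _]addnC.
- move=> [a b] [a' b'] _ _ /= E; have sP := partn_sorted.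
  congr (_, _); apply: val_inj => /=.
    by rewrite -(word_downs b (sP a)) E word_downs.
  by rewrite -(word_ups a (sP b)) E word_ups.
- move=> z [zw wt ze]; have /andP[sz _] := zw.
  have [/partn_exists[b bE] /partn_exists[a aE]] := is_word_partn zw.
  exists (a, b); rewrite /= ?aE ?bE ?word_ups_downs //; split=> /=.
    rewrite aE bE -wt /word_weight -(sumn_perm (perm_ups_downs z)) sumn_cat.
    by rewrite mulnC [X in X + _]addnC.
  by rewrite aE bE ze; lia.
Qed.

Lemma finite_pair_of n d : exists r, counted (pair_of n d) r.
Proof.
exists #|` fset_set [set ab | pair_of n d ab]%classic|.
apply: card_counted; pose T := {bseq n of 'I_n.+1}.
apply: (@sub_finite_set _ _
  ([set (partn_of t.1, partn_of t.2) | t in [set: T * T]])%classic);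
  last exact/finite_image/finite_finset.
move=> [a b] /= [wt _].
have [|t1 t1E] := @partn_of_surj n a; first by rewrite -wt -addnA leq_addr.
have [|t2 t2E] := @partn_of_surj n b; first by rewrite -wt addnAC leq_addl.
by exists (t1, t2); rewrite //= t1E t2E.
Qed.

(** * Counting symbols by their words *)

Lemma word_height_le z : is_word z -> size (ups z) <= word_weight z.
Proof.
move=> /is_word_partn[/partn_exists[a aE] _]; rewrite /word_weight.
rewrite -(sumn_perm (perm_ups_downs z)) sumn_cat -aE.
by apply: leq_trans (size_le_sumn a) _; rewrite -addnA leq_addr.
Qed.

(** Here [p e] is the number of pairs of weight [n] whose lengths differ by
    [e]. *)
Lemma counted_symbol_of k n N (p : nat -> nat) : n < N ->
  (forall e, counted (pair_of n (Posz e)) (p e)) ->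
  counted (symbol_of k n) (\sum_(0 <= e < N) symbol_mult k e * p e).
Proof.
move=> nN cp; pose h z := size (ups z) - size (downs z).
pose w (eta : seq segment * (partn * partn)) := symbol_word eta.1 eta.2.
apply: (counted_fibre (f := fun eta => h (w eta))); first exact: iota_uniq.
  move=> eta [_ symb wt]; rewrite mem_index_iota /=.
  have [/word_height_le + _] := symbol_word_is_word (isT : 0 < 1) symb.
  by rewrite wt /h /w; move: nN; clear; lia.
move=> e _; apply: (counted_fibre_const (f := w) (counted_pair_word_of (cp e))).
  move=> eta [[_ symb wt] he].
  have [zw _] := symbol_word_is_word (isT : 0 < 1) symb.
  by split=> //; rewrite -he /h subnKC // symbol_word_ups_ge.
move=> z [zw wt ze].
apply: counted_ext (counted_symbol_word (c := 1) k zw _ ze) => [eta|].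
  split=> [[se symb wz]|[[[se symb _] _] wz]]; last by split.
  by rewrite /symbol_of /h /w wz wt ze addKn.
case/andP: zw => _ z0; apply/allP => x xz; rewrite lt0n.
by apply: contraNneq z0 => <-.
Qed.

(** * The multiplicity as a sum of binomial coefficients *)

Lemma symbol_multS k e : symbol_mult k.+1 e.+1 =
  symbol_mult k.+1 e + \sum_(0 <= j < e.+1) symbol_mult k j.
Proof.
rewrite /= big_nat_recr //= [X in _ = _ + X]big_nat_recr //= subSnn muln1 addnA.
congr (_ + _); rewrite -big_split /=; apply: eq_big_nat => j /andP[_ lt_j].
by rewrite subSn ?mulnS 1?addnC // ltnW.
Qed.

Lemma symbol_mult_sum k :
  (forall e, \sum_(0 <= j < e.+1) symbol_mult k j =
     'C(e + k, k.*2.+1) + 'C((e + k).+1, k.*2.+1)) /\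
  (forall e, symbol_mult k.+1 e = 'C(e + k, k.*2.+2) + 'C((e + k).+1, k.*2.+2)).
Proof.
have step j : (forall e, \sum_(0 <= i < e.+1) symbol_mult j i =
     'C(e + j, j.*2.+1) + 'C((e + j).+1, j.*2.+1)) ->
  forall e, symbol_mult j.+1 e = 'C(e + j, j.*2.+2) + 'C((e + j).+1, j.*2.+2).
  move=> sumj; elim=> [|e IHe].
    by rewrite /= big_geq // !bin_small //; lia.
  by rewrite symbol_multS IHe sumj addSn [in RHS]binS [in RHS](binS (e + j).+1); lia.
elim: k => [|k [_ IHk]].
  suff C0 e : \sum_(0 <= j < e.+1) symbol_mult 0 j =
      'C(e + 0, 0.*2.+1) + 'C((e + 0).+1, 0.*2.+1) by split=> //; apply: step.
  elim: e => [|e IHe]; first by rewrite big_nat1.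
  by rewrite big_nat_recr //= IHe /= !bin1; lia.
suff Ck e : \sum_(0 <= j < e.+1) symbol_mult k.+1 j =
    'C(e + k.+1, k.+1.*2.+1) + 'C((e + k.+1).+1, k.+1.*2.+1).
  by split=> //; apply: step.
elim: e => [|e IHe].
  by rewrite big_nat1 /= big_geq // !bin_small //; lia.
rewrite big_nat_recr // IHe IHk doubleS !addSn !addnS.
rewrite [in RHS]binS [in RHS](binS (e + k).+2); exact: addnACA.
Qed.

(** * Symmetrized crank moments *)

Section CrankMoments.
Import Order.TTheory GRing.Theory Num.Theory.
Local Open Scope ring_scope.

Lemma binomial_int_nat (n j : nat) : binomial_int n%:Z j = 'C(n, j)%:R.
Proof.
rewrite /binomial_int.
have -> : \prod_(i < j) ((n%:Z - (i : nat)%:Z)%:~R : rat) = (n ^_ j)%:R.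
  elim: j => [|j IHj]; first by rewrite big_ord0.
  rewrite big_ord_recr /= IHj ffactnSr natrM.
  have [le_jn|lt_nj] := leqP j n; first by rewrite subzn.
  by rewrite ffact_small // !mul0r.
by rewrite -bin_ffact natrM mulfK // pnatr_eq0 -lt0n fact_gt0.
Qed.

Lemma binomial_int_reflect (x : int) (j : nat) :
  binomial_int (j%:Z - 1 - x) j = (-1) ^+ j * binomial_int x j.
Proof.
rewrite /binomial_int mulrA; congr (_ / _).
rewrite (reindex_inj rev_ord_inj) /=.
rewrite -[X in (-1) ^+ X](card_ord j) -prodrN.
apply: eq_bigr => i _; rewrite -rmorphN /=; congr (_%:~R).
by have := ltn_ord i; lia.
Qed.

(** The two binomial coefficients that belong to the cranks [e] and [- e]. *)
Lemma binomial_int_symbol_mult (k e : nat) :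
  binomial_int (e%:Z + k.+1%:Z - 1) (2 * k.+1) +
  binomial_int (- e%:Z + k.+1%:Z - 1) (2 * k.+1) = (symbol_mult k.+1 e)%:R.
Proof.
have [_ ->] := symbol_mult_sum k; rewrite natrD mul2n doubleS; congr (_ + _).
  have -> : e%:Z + k.+1%:Z - 1 = (e + k)%N%:Z by lia.
  exact: binomial_int_nat.
have -> : - e%:Z + k.+1%:Z - 1 = k.*2.+2%:Z - 1 - (e + k).+1%:Z by lia.
rewrite binomial_int_reflect binomial_int_nat.
by rewrite -signr_odd /= negbK odd_double expr0 mul1r.
Qed.

Lemma counted_crank_count (d : int) (n : nat) :
  counted (fun la : partn => sumn la = n /\ crank la = d) (crank_count d n).
Proof.
apply: card_counted; apply: sub_finite_set (finite_partitions n).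
by move=> la [].
Qed.

Lemma pair_of_height n (d : int) ab : pair_of n d ab -> (`|d| <= n)%N.
Proof.
case: ab => a b [/= <- <-]; have := size_le_sumn a; have := size_le_sumn b.
move: (sumn a) (sumn b) (size a * size b)%N (size a) (size b); clear; lia.
Qed.

Lemma symmetrized_crank_momentE (k n : nat) : (0 < n)%N ->
  symmetrized_crank_moment k.+1 n.+1 =
  #|` fset_set (marked_Dyson_symbols k.+2 n.+1)|%:R.
Proof.
move=> n0.
have [p pP] : {p : nat -> int -> nat | forall m d, counted (pair_of m d) (p m d)}.
  exists (fun m d => projT1 (cid (finite_pair_of m d))) => m d.
  exact: projT2 (cid _).
have pN m d : p m (- d) = p m d.
  exact: counted_inj (pP _ _) (counted_pair_sym (pP _ _)).
have p0 m (d : int) : (m < `|d|)%N -> p m d = 0%N.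
  move=> lt; apply: counted_inj (pP m d) (counted0 _) => ab /pair_of_height.
  by rewrite leqNgt lt.
have crankE d : (p n.+1 d = crank_count d n.+1 + p n d)%N.
  apply: counted_inj (counted_crank_pair (pP _ _)) _.
  exact: counted_crank n0 (counted_crank_pair (pP n d)) (counted_crank_count d n.+1).
have crankN d : crank_count (- d) n.+1 = crank_count d n.+1.
  by apply/eqP; rewrite -(eqn_add2r (p n d)) -{1}(pN n) -!crankE pN.
set s := #|` _ |; pose N := n.+2.
have sE : (\sum_(0 <= e < N) symbol_mult k.+1 e * p n.+1 e%:Z =
    s + \sum_(0 <= e < N) symbol_mult k.+1 e * p n e%:Z)%N.
  apply: counted_inj (counted_symbol_of k.+1 _ (fun e => pP n.+1 e%:Z)) _ => //.
  apply: counted_tight (counted_symbol_of k.+1 _ (fun e => pP n e%:Z)) _ => //.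
  apply: counted_marked_Dyson; apply: card_counted.
  exact: finite_marked_Dyson_symbols.
have -> : (s = \sum_(0 <= e < N) symbol_mult k.+1 e * crank_count e%:Z n.+1)%N.
  apply/eqP; rewrite -(eqn_add2r (\sum_(0 <= e < N) symbol_mult k.+1 e * p n e%:Z)).
  rewrite -sE -big_split /=; apply/eqP/eq_bigr => e _.
  by rewrite crankE mulnDr.
rewrite /symmetrized_crank_moment natr_sum.
(* No partition of [n.+1] has a crank outside [-(n + 1), n + 1]. The crank 0
   has a zero coefficient, so it may be counted with both signs. *)
pose r := [seq e%:Z | e <- iota 0 N] ++ [seq - e.+1%:Z | e <- iota 0 n.+1].
have ur : uniq r.
  rewrite cat_uniq; apply/and3P; split.
  - by rewrite map_inj_uniq ?iota_uniq // => x y []; lia.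
  - by apply/hasPn => _ /mapP[e _ ->]; apply/mapP => -[x _]; lia.
  - by rewrite map_inj_uniq ?iota_uniq // => x y; lia.
rewrite (fsbigE r) //=; last first.
  move=> d _ dr; suff -> : crank_count d n.+1 = 0%N by rewrite mulr0.
  have : p n.+1 d = 0%N; last by rewrite crankE; lia.
  apply: p0; rewrite ltnNge; apply: contra dr => le_d.
  rewrite mem_cat; case: d le_d => e le_e; apply/orP; [left|right].
    by apply/mapP; exists e; rewrite // mem_iota /=; lia.
  by apply/mapP; exists e; rewrite // mem_iota /=; lia.
under eq_bigl do rewrite in_setT.
rewrite big_cat !big_map (_ : iota 0 N = index_iota 0 N); last first.
  by rewrite /index_iota subn0.
have -> : \sum_(j <- iota 0 n.+1) binomial_int (- j.+1%:Z + k.+1%:Z - 1) (2 * k.+1)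
     * (crank_count (- j.+1%:Z) n.+1)%:R =
   \sum_(0 <= j < N) binomial_int (- j%:Z + k.+1%:Z - 1) (2 * k.+1)
     * (crank_count (- j%:Z) n.+1)%:R.
  rewrite big_nat_recl // [X in _ = X * _ + _](_ : _ = 0) ?mul0r ?add0r.
    by rewrite /index_iota subn0.
  have -> : k.+1%:Z - 1 = k%:Z by lia.
  by rewrite binomial_int_nat bin_small //; lia.
rewrite [LHS]/= -big_split; apply: eq_bigr => e _; rewrite [LHS]/=.
by rewrite crankN -mulrDl binomial_int_symbol_mult natrM.
Qed.

End CrankMoments.

Theorem theorem3p1 (k n : nat) (hk : 1 <= k) (hn : 2 <= n) :
  symmetrized_crank_moment k n
  = (#|` fset_set (marked_Dyson_symbols (k + 1) n)|%:R)%R.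
Proof.
case: k hk => // k _; case: n hn => // n n0; rewrite addn1.
exact: symmetrized_crank_momentE.
Qed.
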